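(* Let $K$ be a complex number and let $\mathcal{Z}_K$ be the variety of all solutions $c:\overline\Omega_\Gamma\to\mathbb{C}$ (with the convention $c(-\bar\alpha)=-c(\bar\alpha)$) of the equations $$c(\bar\alpha+\bar\beta)\,(c(\bar\alpha)+c(\bar\beta))=c(\bar\alpha)c(\bar\beta)+K^2$$ for all pairs of positive quasiroots $\bar\alpha,\bar\beta$ such that $\bar\alpha+\bar\beta$ is a quasiroot; or, what is the same, the variety of invariant brackets $f=\sum c(\bar\alpha)E_\alpha\wedge E_{-\alpha}$ on $M=G/G_\Gamma$ such that $[\![f,f]\!]=K^2\varphi_M$. The variety $\mathcal{Z}_K$ splits into strata. Each stratum is defined by choosing a linear subset $\overline\Omega'$ of $\overline\Omega_\Gamma$ and a semilinear subset $X$ of $\pi(\overline\Omega_\Gamma)$. Points of this stratum are parameterized by the multiplicative regular maps $\lambda:\overline\Omega'\to\mathbb{C}^*$. Let the data $(\overline\Omega',X,\lambda)$ correspond to a point of $\mathcal{Z}_K$. Then the coefficients $c(\bar\alpha)$ of $f$ are determined in the following way: if $\bar\alpha\in\overline\Omega'$, then $$c(\bar\alpha)=K\psi(\lambda(\bar\alpha)),\qquad \psi(x)=\frac{x+1}{x-1};$$ if $\pi(\bar\alpha)\in X$, then $c(\bar\alpha)=K$; if $\pi(\bar\alpha)\in -X$, then $c(\bar\alpha)=-K$.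
   Context: $\mathfrak{g}$ is a simple complex Lie algebra, $\mathfrak{h}$ a Cartan subalgebra, $\Omega$ the root system, $\Omega^+$ the positive roots, $\Pi$ the simple roots; $E_{\pm\alpha}$ ($\alpha\in\Omega^+$) are root vectors with $(E_\alpha,E_{-\alpha})=1$ for the Killing form. $\Gamma\subset\Pi$; $\mathfrak{h}^*_\Gamma$ is the span of $\Gamma$, $\Omega_\Gamma=\Omega\cap\mathfrak{h}_\Gamma^*$; $\mathfrak{g}_\Gamma$ is the Levi subalgebra generated by $\mathfrak{h}$ and $E_{\pm\alpha}$, $\alpha\in\Gamma$; $\mathfrak{m}$ is the span of $E_{\pm\gamma}$, $\gamma\in\Omega^+\setminus\Omega_\Gamma$; $G$ is a connected complex Lie group with Lie algebra $\mathfrak{g}$, $G_\Gamma$ the Levi subgroup with Lie algebra $\mathfrak{g}_\Gamma$, and $M=G/G_\Gamma$ (isomorphic to a semisimple orbit in $\mathfrak{g}^*$). Quasiroots: $\overline\Omega_\Gamma$ is the set of nonzero images of elements of $\Omega$ in $\mathfrak{h}^*/\mathfrak{h}^*_\Gamma$; $\bar\alpha$ is the image of $\alpha$; positive quasiroots are the nonzero images of positive roots. Invariant brackets (bivector fields) on $M$ correspond to $\mathfrak{g}_\Gamma$-invariant elements of $\wedge^2\mathfrak{m}$, and these are exactly the elements $\sum_{\alpha\in\Omega^+\setminus\Omega_\Gamma}c(\bar\alpha)E_\alpha\wedge E_{-\alpha}$ with coefficients depending only on $\bar\alpha$. $[\![\cdot,\cdot]\!]$ is the Schouten bracket. $\varphi_M$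 is the invariant three-vector field on $M$ determined by the invariant element $\varphi=[\![r,r]\!]\in\wedge^3\mathfrak{g}$, where $r=\sum_{\alpha\in\Omega^+}E_\alpha\wedge E_{-\alpha}$; the normalization is such that $[\![f,f]\!]=K^2\varphi_M$ is equivalent to the displayed system. A subset $\overline\Omega'\subset\overline\Omega_\Gamma$ is linear if $\overline\Omega'=\overline\Omega_\Gamma\cap\mathrm{span}(\overline\Omega')$, where $\mathrm{span}(\overline\Omega')\subset\mathfrak{h}^*/\mathfrak{h}^*_\Gamma$ is the vector subspace generated by $\overline\Omega'$. For the point of $\mathcal{Z}_K$ given by $c$, $\overline\Omega'$ is the subset of quasiroots with $c(\bar\alpha)\neq\pm K$. Given $\overline\Omega'$, $\pi:\mathfrak{h}^*/\mathfrak{h}^*_\Gamma\to(\mathfrak{h}^*/\mathfrak{h}^*_\Gamma)/\mathrm{span}(\overline\Omega')$ is the natural map, and $\pi(\overline\Omega_\Gamma)$ denotes the image of $\overline\Omega_\Gamma$ without zero. A subset $X\subset\pi(\overline\Omega_\Gamma)$ is semilinear if $x_1,x_2\in X$ and $x_1+x_2\in\pi(\overline\Omega_\Gamma)$ imply $x_1+x_2\in X$, and $X\cap(-X)=\emptyset$, $X\cup(-X)=\pi(\overline\Omega_\Gamma)$. A map $\lambda:\overline\Omega'\to\mathbb{C}^*$ is multiplicative if $\lambda(\bar\alpha+\bar\beta)=\lambda(\bar\alpha)\lambda(\bar\beta)$ whenever $\bar\alpha,\bar\beta,\bar\alpha+\bar\beta\in\overline\Omega'$; it is defined by its values $\lambda(\bar\alpha_i)=\lambda_i\neq0,1$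 on elements $\bar\alpha_1,\dots,\bar\alpha_k$ of $\overline\Omega'$ forming a basis of $\mathrm{span}(\overline\Omega')$, where $c(\bar\alpha_i)=K\psi(\lambda_i)$. It is regular if, whenever $\bar\alpha,\bar\beta,\bar\alpha+\bar\beta\in\overline\Omega'$, one has $\lambda(\bar\alpha)\lambda(\bar\beta)=1$ only when $\bar\alpha=-\bar\beta$. In the case $K=0$ the choice of $X$ does not matter: a stratum of $\mathcal{Z}_0$ is determined only by choosing $\overline\Omega'$.
   Formalization: The splitting into strata and the parameterization by λ are proved for K ≠ 0 (for K = 0 the formula c = Kψ(λ) would give only c = 0); multiplicative regular λ are also required to satisfy λ(-ᾱ) = 1/λ(ᾱ) and λ(ᾱ) ≠ 1. *)

(* Defs.v *)
From HB Require Import structures.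
From mathcomp Require Import all_boot all_order all_algebra.
From mathcomp Require Import boolp reals complex finmap.

Set Implicit Arguments.
Unset Strict Implicit.
Unset Printing Implicit Defensive.

Import Order.TTheory GRing.Theory Num.Theory.
Local Open Scope ring_scope.

(* Quotient of a finite dimensional space V by a subspace W, realized on the
   complement W^C; [qproj W] is the natural map: it is onto with kernel W
   (lemmas [lker_qproj] and [limg_qproj]). *)
Definition quot (F : fieldType) (V : vectType F) (W : {vspace V}) :=
  subvs_of (W^C)%VS.

Definition qproj (F : fieldType) (V : vectType F) (W : {vspace V}) :
    'Hom(V, quot W) :=
  (linfun (vsproj (W^C)%VS) \o daddv_pi (W^C)%VS W)%VF.

Lemma val_qproj (F : fieldType) (V : vectType F) (W : {vspace V}) (v : V) :
  vsval (qproj W v) = daddv_pi (W^C)%VS W v.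
Proof. by rewrite comp_lfunE lfunE /= vsprojK // memv_pi. Qed.

Lemma lker_qproj (F : fieldType) (V : vectType F) (W : {vspace V}) :
  lker (qproj W) = W.
Proof.
have capCW : (W^C :&: W = 0)%VS by rewrite capvC capv_compl.
have addCW v : (v \in W^C + W)%VS by rewrite addvC addv_complf memvf.
apply/vspaceP => v; rewrite memv_ker; apply/eqP/idP => [q0|vW].
  rewrite -(daddv_pi_add capCW (addCW v)) -val_qproj q0 linear0 add0r.
  exact: memv_pi.
apply: val_inj; rewrite [LHS]val_qproj [RHS]linear0.
apply: (addIr (daddv_pi W (W^C)%VS v)).
by rewrite daddv_pi_add // add0r daddv_pi_id // capv_compl.
Qed.

Lemma limg_qproj (F : fieldType) (V : vectType F) (W : {vspace V}) :
  limg (qproj W) = fullv.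
Proof.
apply/vspaceP => x; rewrite memvf; apply/memv_imgP; exists (vsval x).
  exact: memvf.
apply: val_inj; rewrite [RHS]val_qproj daddv_pi_id ?subvsP //.
by rewrite capvC capv_compl.
Qed.

Definition fspan (F : fieldType) (V : vectType F) (A : {fset V}) : {vspace V} :=
  <<enum_fset A>>%VS.

(** Simple complex Lie algebras *)

Section LieAlgebra.
Variables (R : realType) (g : vectType R[i]).

(* A bilinear bracket [x, y] on g is given by x |-> ad x, so that
   [x, y] = ad x y. *)
Variable ad : 'Hom(g, 'End(g)).

Definition lie_bracket : Prop :=
  (forall x, ad x x = 0) /\
  (forall x y z, ad x (ad y z) + ad y (ad z x) + ad z (ad x y) = 0).

Definition lie_ideal (U : {vspace g}) : Prop :=
  forall x u, u \in U -> ad x u \in U.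

Definition simple_lie : Prop :=
  [/\ lie_bracket, exists x y, ad x y != 0 &
      forall U, lie_ideal U -> U = 0%VS \/ U = fullv].

Definition lie_subalgebra (U : {vspace g}) : Prop :=
  forall x y, x \in U -> y \in U -> ad x y \in U.

Definition trace (f : 'End(g)) : R[i] :=
  \tr (passmx.mxof (vbasis {:g}) (vbasis {:g}) f).

Definition killing (x y : g) : R[i] := trace (ad x \o ad y)%VF.

Definition ad_diagonalizable (x : g) : Prop :=
  exists2 b : seq g, basis_of fullv b &
    forall v, v \in b -> exists a : R[i], ad x v = a *: v.

(* A Cartan subalgebra of a semisimple complex Lie algebra: a maximal abelian
   subalgebra all of whose elements are ad-diagonalizable. *)
Definition cartan_subalgebra (h : {vspace g}) : Prop :=
  [/\ forall s t, s \in h -> t \in h -> ad s t = 0,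
      forall x, (forall t, t \in h -> ad t x = 0) -> x \in h &
      forall t, t \in h -> ad_diagonalizable t].

Definition dual (h : {vspace g}) := 'Hom(subvs_of h, R[i]^o).

Variable h : {vspace g}.

Definition root_vector (alpha : dual h) (x : g) : Prop :=
  forall t : subvs_of h, ad (vsval t) x = alpha t *: x.

Definition is_root (alpha : dual h) : Prop :=
  alpha != 0 /\ exists2 x : g, x != 0 & root_vector alpha x.

Definition nat_comb (Pi : {fset dual h}) (alpha : dual h) : Prop :=
  exists n : dual h -> nat, alpha = \sum_(s <- enum_fset Pi) s *+ n s.

Definition simple_roots (Omega Pi : {fset dual h}) : Prop :=
  [/\ (Pi `<=` Omega)%fset, free (enum_fset Pi) &
      forall alpha, alpha \in Omega -> nat_comb Pi alpha \/ nat_comb Pi (- alpha)].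

Definition positive_roots (Omega Pi : {fset dual h}) : {fset dual h} :=
  [fset alpha in Omega | `[< nat_comb Pi alpha >]]%fset.

Definition normalized_root_vectors (Omega : {fset dual h}) (E : dual h -> g) :
    Prop :=
  (forall alpha, alpha \in Omega -> root_vector alpha (E alpha)) /\
  (forall alpha, alpha \in Omega -> killing (E alpha) (E (- alpha)) = 1).

(* x lies in the Levi subalgebra generated by h and the E_{+-alpha},
   alpha in Gamma *)
Definition in_levi (Gamma : {fset dual h}) (E : dual h -> g) (x : g) : Prop :=
  forall U : {vspace g}, lie_subalgebra U -> (h <= U)%VS ->
    (forall alpha, alpha \in Gamma -> E alpha \in U /\ E (- alpha) \in U) ->
    x \in U.

(** Polyvectors *)

(* The element x /\ y /\ z of the third exterior power of g, as an alternating
   form on g^*. *)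
Definition wedge3 (x y z : g) (xi : 'I_3 -> 'Hom(g, R[i]^o)) : R[i] :=
  \det (\matrix_(i, j) (xi i (tnth [tuple x; y; z] j) : R[i])).

(* The sequence of the (a_k, x_k, y_k) stands for \sum_k a_k x_k /\ y_k. *)
Definition bivector := seq (R[i] * (g * g)).

Definition schouten (f f' : bivector) (xi : 'I_3 -> 'Hom(g, R[i]^o)) : R[i] :=
  \sum_(p <- f) \sum_(q <- f')
    let: (a, (x1, x2)) := p in let: (b, (y1, y2)) := q in
    a * b * (wedge3 (ad x1 y1) x2 y2 xi - wedge3 (ad x1 y2) x2 y1 xi
             - wedge3 (ad x2 y1) x1 y2 xi + wedge3 (ad x2 y2) x1 y1 xi).

End LieAlgebra.

(** Quasiroots and the variety Z_K *)

Definition ext0 (T : choiceType) (R : nmodType) (A : {fset T}) (c : A -> R)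
    (x : T) : R :=
  oapp c 0 (insub x).

Section Quasiroots.
Variables (R : realType) (g : vectType R[i]) (ad : 'Hom(g, 'End(g))).
Variables (h : {vspace g}) (Omega Pi Gamma : {fset dual h}) (E : dual h -> g).
Variable K : R[i].

Definition quasiroots : {fset quot (fspan Gamma)} :=
  ([fset qproj (fspan Gamma) alpha | alpha in Omega] `\ 0)%fset.

Definition positive_quasiroot (x : quot (fspan Gamma)) : Prop :=
  x \in quasiroots /\
  exists2 alpha, alpha \in positive_roots Omega Pi &
    x = qproj (fspan Gamma) alpha.

Definition odd_coef (c : {ffun quasiroots -> R[i]}) : Prop :=
  forall a b : quasiroots, val b = - val a -> c b = - c a.

Definition Z_variety (c : {ffun quasiroots -> R[i]}) : Prop :=
  odd_coef c /\
  forall a b s : quasiroots,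
    positive_quasiroot (val a) -> positive_quasiroot (val b) ->
    val s = val a + val b ->
    c s * (c a + c b) = c a * c b + K ^+ 2.

Definition r_bivector : bivector g :=
  [seq (1, (E alpha, E (- alpha))) |
     alpha <- enum_fset (positive_roots Omega Pi)].

(* \sum c(bar alpha) E_alpha /\ E_{- alpha} over the positive roots outside
   Omega_Gamma, the intersection of Omega with the span of Gamma *)
Definition f_bivector (c : {ffun quasiroots -> R[i]}) : bivector g :=
  [seq (ext0 c (qproj (fspan Gamma) alpha), (E alpha, E (- alpha))) |
     alpha <- enum_fset (positive_roots Omega Pi) & alpha \notin fspan Gamma].

(* [[f, f]] = K^2 phi_M on M = G / G_Gamma: invariant three-vector fields on M
   are read off at the base point, in the third exterior power of g / g_Gamma,
   that is, on linear forms which vanish on the Levi subalgebra g_Gamma. *)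
Definition bracket_equation (c : {ffun quasiroots -> R[i]}) : Prop :=
  forall xi : 'I_3 -> 'Hom(g, R[i]^o),
    (forall i x, in_levi ad Gamma E x -> xi i x = 0) ->
    schouten ad (f_bivector c) (f_bivector c) xi
    = K ^+ 2 * schouten ad r_bivector r_bivector xi.

(** Strata *)

Definition linear_subset (O' : {fset quot (fspan Gamma)}) : Prop :=
  O' = [fset x in quasiroots | x \in fspan O']%fset.

(* pi (quasiroots), without zero *)
Definition pi_quasiroots (O' : {fset quot (fspan Gamma)}) :
    {fset quot (fspan O')} :=
  ([fset qproj (fspan O') x | x in quasiroots] `\ 0)%fset.

Definition semilinear_subset (O' : {fset quot (fspan Gamma)})
    (X : {fset quot (fspan O')}) : Prop :=
  [/\ (X `<=` pi_quasiroots O')%fset,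
      forall x1 x2, x1 \in X -> x2 \in X ->
        x1 + x2 \in pi_quasiroots O' -> x1 + x2 \in X,
      (X `&` [fset - x | x in X])%fset = fset0 &
      (X `|` [fset - x | x in X])%fset = pi_quasiroots O'].

(* The second clause of [multiplicative_map] goes with c(- a) = - c(a); it follows
   from the first one except for the elements of O' which occur in no relation
   a + b = s inside O'. *)
Definition multiplicative_map (O' : {fset quot (fspan Gamma)})
    (lambda : {ffun O' -> R[i]}) : Prop :=
  [/\ forall a, lambda a != 0,
      forall a b s : O', val s = val a + val b ->
        lambda s = lambda a * lambda b &
      forall a b : O', val b = - val a -> lambda b = (lambda a)^-1].

(* Likewise, lambda != 1 has to be required only for the elements which occur
   in no relation a + b = s. *)
Definition regular_map (O' : {fset quot (fspan Gamma)})
    (lambda : {ffun O' -> R[i]}) : Prop :=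
  (forall a, lambda a != 1) /\
  (forall a b s : O', val s = val a + val b -> lambda a * lambda b = 1 ->
     val a = - val b).

Definition psi (x : R[i]) : R[i] := (x + 1) / (x - 1).

Definition corresponds (O' : {fset quot (fspan Gamma)})
    (X : {fset quot (fspan O')}) (lambda : {ffun O' -> R[i]})
    (c : {ffun quasiroots -> R[i]}) : Prop :=
  [/\ forall (a : quasiroots) (a' : O'), val a' = val a ->
        c a = K * psi (lambda a'),
      forall a : quasiroots, qproj (fspan O') (val a) \in X -> c a = K &
      forall a : quasiroots, - qproj (fspan O') (val a) \in X -> c a = - K].

(* For K != 0: O' is where c differs from +-K, X is where c = K. *)
Definition in_stratum (O' : {fset quot (fspan Gamma)})
    (X : {fset quot (fspan O')}) (c : {ffun quasiroots -> R[i]}) : Prop :=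
  Z_variety c /\
  forall a : quasiroots,
    [/\ val a \in O' <-> (c a <> K /\ c a <> - K),
        qproj (fspan O') (val a) \in X <-> c a = K &
        - qproj (fspan O') (val a) \in X <-> c a = - K].

End Quasiroots.

(* Main.v *)
(* Root theory.  If u has weight r and [E_{-a}, [E_a, u]] = 0, looking at the last
   nonzero vector ad(E_{-a})^k u shows that r(t_a) = (k/2) a(t_a) for some natural
   number k, where t_a = [E_a, E_{-a}].  This gives a(t_a) != 0, one-dimensional
   root spaces, [E_a, E_b] != 0 when a + b is a root, and the combinatorial fact on
   which everything else rests: in a relation a + b_1 + ... + b_n = 0 between
   roots, some a + b_i is a root or zero.

   Equations.  With coefficients extended as an odd function of the root, [[f, f]]
   becomes a sum over the triples a + b + c = 0 of roots with coefficient
   c_a c_b + c_b c_c + c_c c_a, and [[r, r]] is the same sum with coefficient - 1.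
   The triples are separated by evaluating on the basis dual to the E_{-a}, and
   every relation between quasiroots lifts to a relation between roots.

   Strata.  For K != 0 the equation is the multiplicativity of
   lambda = (c + K)/(c - K), and the roots with c != - K form a parabolic subset T.
   Whenever a sum of elements of T lies in the complex, hence in the rational, span
   of the intersection of T and - T, the opposites of its terms are in T too; this
   makes the set where c != K, - K linear, and the set where c = K semilinear after
   projection. *)
From HB Require Import structures.
Require Import Defs.
From mathcomp Require Import all_boot all_order all_algebra.
From mathcomp Require Import boolp reals complex finmap.
From mathcomp Require Import ring.

Set Implicit Arguments.
Unset Strict Implicit.
Unset Printing Implicit Defensive.

Import Order.TTheory GRing.Theory Num.Theory passmx.
Local Open Scope ring_scope.

(** The property of sums of roots needs neither reflections nor an inner product: only the
    nonnegativity of k in the relation between r(t_a) and a(t_a) enters. The obstacle in the last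
    part is that closedness of T speaks of sums of roots, with natural multiplicities, whereas a
    linear subset is cut out by a complex subspace. Since roots have integral coordinates in the
    free family [Pi], a complex relation can be replaced by an integral one, and the symmetry of the
    intersection of T and - T turns its negative coefficients into sums of roots again. Quasiroots
    are handled through lifts to roots. A root in the span of [Gamma] carries no coefficient; it
    gets the value 0, which for K != 0 differs from both K and - K. Such roots therefore lie in T
    and in - T, and the kernel of the projection is absorbed into the span of their intersection. *)

Lemma mulrn_inj (F : numFieldType) (V : lmodType F) (v : V) :
  v != 0 -> injective (GRing.natmul v).
Proof.
move=> v0 i j /eqP; rewrite -!scaler_nat -subr_eq0 -scalerBl scaler_eq0.
by rewrite (negPf v0) orbF subr_eq0 eqr_nat => /eqP.
Qed.

Lemma mulrn_lfunE (F : fieldType) (V : vectType F) (f : 'Hom(V, F^o)) n v :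
  (f *+ n) v = (f v : F) *+ n.
Proof. by elim: n => [|n IHn]; rewrite ?zero_lfunE // !mulrS add_lfunE IHn. Qed.

(** * Root spaces *)

Section KillingForm.
Variables (R : realType) (g : vectType R[i]) (ad : 'Hom(g, 'End(g))).

Lemma trace_compC (u v : 'End(g)) : trace (u \o v)%VF = trace (v \o u)%VF.
Proof.
have be := vbasisP {:g}.
by rewrite /trace !((mxof_comp _ _ be)) mxtrace_mulC.
Qed.

Lemma traceD (u v : 'End(g)) : trace (u + v) = trace u + trace v.
Proof. by rewrite /trace linearD /= mxtraceD. Qed.

Lemma traceZ (a : R[i]) (u : 'End(g)) : trace (a *: u) = a * trace u.
Proof. by rewrite /trace linearZ /= mxtraceZ. Qed.

Lemma killingC x y : killing ad x y = killing ad y x.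
Proof. exact: trace_compC. Qed.

Lemma killing_linear x : linear_for *%R (killing ad x).
Proof.
by move=> a y z; rewrite /killing linearP comp_lfunDr -comp_lfunZr traceD traceZ.
Qed.

HB.instance Definition _ x := GRing.isSemilinear.Build R[i] g R[i]^o _
  (killing ad x) (GRing.semilinear_linear (killing_linear x)).

Lemma killingZl a x y : killing ad (a *: x) y = a * killing ad x y.
Proof. by rewrite killingC linearZ /= killingC. Qed.

Lemma killing0l x : killing ad 0 x = 0.
Proof. by rewrite killingC linear0. Qed.

Lemma killingNl x y : killing ad (- x) y = - killing ad x y.
Proof. by rewrite -scaleN1r killingZl mulN1r. Qed.

Hypothesis ad_lie : lie_bracket ad.

Lemma ad_anti x y : ad x y = - ad y x.
Proof.
case: ad_lie => alt _; have := alt (x + y).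
rewrite !linearD /= !add_lfunE !alt add0r addr0 => /eqP.
by rewrite addrC addr_eq0 => /eqP.
Qed.

Lemma ad_derivation x y z : ad x (ad y z) = ad (ad x y) z + ad y (ad x z).
Proof.
case: ad_lie => _ jac; have := jac x y z.
rewrite (ad_anti z (ad x y)) (ad_anti z x) linearN /= => /eqP.
by rewrite subr_eq0 => /eqP <-; rewrite subrK.
Qed.

Lemma ad_bracket x y : ad (ad x y) = (ad x \o ad y)%VF - (ad y \o ad x)%VF.
Proof.
apply/lfunP => z; rewrite add_lfunE opp_lfunE !comp_lfunE ad_derivation.
by rewrite addrK.
Qed.

Lemma killing_invariant x y z : killing ad (ad x y) z = killing ad x (ad y z).
Proof.
rewrite /killing !ad_bracket comp_lfunDl comp_lfunDr comp_lfunNl comp_lfunNr.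
rewrite !traceD -!(scaleN1r (_ \o _)%VF) !traceZ; congr (_ + _ * _).
  by rewrite comp_lfunA.
by rewrite -comp_lfunA trace_compC comp_lfunA.
Qed.

End KillingForm.

(** * Simultaneous diagonalization of a Cartan subalgebra *)

Section CartanSubalgebra.
Variables (R : realType) (g : vectType R[i]) (ad : 'Hom(g, 'End(g))).
Variable h : {vspace g}.
Hypothesis ad_lie : lie_bracket ad.
Hypothesis h_cartan : cartan_subalgebra ad h.

Lemma ad_diagonalizable_mx (t : g) : ad_diagonalizable ad t ->
  diagonalizable (mxof (vbasis {:g}) (vbasis {:g}) (ad t)).
Proof.
case=> b b_basis b_eigen; set e := vbasis {:g}; have e_basis := vbasisP {:g}.
(* The rows of [P] are the eigenvectors in [b]. Their number equals the dimension only
   propositionally; the criterion for rectangular matrices of full rank avoids a cast. *)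
apply/codiagonalizable1/codiagonalizablePfull; exists (size b).
pose P : 'M[R[i]]_(size b, \dim {:g}) := \matrix_i rVof e b`_i.
have b_dim : size b = \dim {:g} by rewrite (size_basis (X := in_tuple b) b_basis).
have P_full : row_full P.
  rewrite -sub1mx; apply/row_subP => i.
  rewrite -[row i _](vecofK e_basis) /=.
  have : vecof e (row i 1%:M) \in <<in_tuple b>>%VS.
    by rewrite /= (span_basis b_basis) memvf.
  move=> /coord_span ->.
  rewrite linear_sum; apply: summx_sub => j _; rewrite linearZ scalemx_sub //.
  by apply: (submx_trans _ (row_sub j P)); rewrite rowK.
exists P => //=; rewrite andbT.
have /choice[a aP] (i : 'I_(size b)) : exists a : R[i], ad t b`_i = a *: b`_i.
  by apply: b_eigen; rewrite mem_nth.
apply/diagonalizable_forPex; exists (\row_i a i); apply: simmxW.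
  by rewrite /row_free (eqP P_full) b_dim.
apply/row_matrixP => i; rewrite !row_mul row_diag_mx -scalemxAl -rowE rowK.
by rewrite -rVof_app // aP linearZ mxE.
Qed.

(** A basis of [h] acts by commuting diagonalizable matrices, so one invertible matrix diagonalizes
    them all; its rows are the weight vectors. *)
Lemma weight_basis : exists2 s : seq g, basis_of fullv s &
  forall v, v \in s -> exists a : dual h, root_vector ad a v.
Proof.
case: h_cartan => h_comm h_max h_diag.
set e := vbasis {:g}; have e_basis := vbasisP {:g}.
pose A u := mxof e e (ad u).
have [P Punit /allP/= Pdiag] : codiagonalizable [seq A u | u <- vbasis h].
  apply/codiagonalizableP; split=> [_ _ /mapP[u uh ->] /mapP[v vh ->]|].
    rewrite /comm_mx /A -!(mxof_comp _ _ e_basis).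
    congr (mxof _ _ _); apply/lfunP => z; rewrite !comp_lfunE.
    rewrite (ad_derivation ad_lie) (h_comm v u) ?vbasis_mem //.
    by rewrite linear0 zero_lfunE add0r.
  move=> _ /mapP[u uh ->]; apply: ad_diagonalizable_mx.
  by apply: h_diag; apply: vbasis_mem.
pose s := [seq vecof e (row i P) | i <- enum 'I_(\dim {:g})].
have s_span : <<s>>%VS = fullv.
  apply/eqP; rewrite eqEsubv subvf; apply/subvP => v _.
  rewrite -[v](rVofK e_basis) -(mulmxKV Punit (rVof e v)).
  rewrite mulmx_sum_row linear_sum; apply: memv_suml => i _.
  rewrite linearZ memvZ // memv_span //.
  by apply/mapP; exists i; rewrite ?mem_enum.
exists s => [|_ /mapP[i _ ->]].
  by rewrite basisEdim s_span subvv size_map size_enum_ord /= leqnn.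
have /choice[d dP] (j : 'I_(\dim h)) : exists a : R[i],
    ad (vbasis h)`_j (vecof e (row i P)) = a *: vecof e (row i P).
  set u := (vbasis h)`_j.
  have uh : u \in vbasis h by rewrite mem_nth // size_tuple.
  have /diagonalizable_forPex[D /(simmxP Punit) PD] := Pdiag _ (map_f _ uh).
  exists (D 0 i); rewrite /= (hom_vecof _ e_basis) -row_mul PD.
  by rewrite row_mul row_diag_mx -scalemxAl -rowE linearZ.
move: (vecof e (row i P)) d dP => v d dP.
exists (\sum_(j < \dim h)
  d j *: (linfun (coord (vbasis h) j : g -> R[i]^o) \o linfun vsval)%VF) => t.
rewrite {1}(coord_vbasis (subvsP t)) linear_sum /= !sum_lfunE scaler_suml.
apply: eq_bigr => j _; rewrite linearZ /= !scale_lfunE dP scalerA.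
by rewrite comp_lfunE !lfunE /= mulrC.
Qed.

End CartanSubalgebra.

(** * Root strings and one-dimensional root spaces *)

Section Roots.
Variables (R : realType) (g : vectType R[i]) (ad : 'Hom(g, 'End(g))).
Variables (h : {vspace g}) (Omega : {fset dual h}) (E : dual h -> g).
Hypothesis g_simple : simple_lie ad.
Hypothesis h_cartan : cartan_subalgebra ad h.
Hypothesis Omega_roots : forall alpha, alpha \in Omega <-> is_root ad alpha.
Hypothesis E_vectors : normalized_root_vectors ad Omega E.

Lemma ad_lie : lie_bracket ad. Proof. by case: g_simple. Qed.

Lemma root_vector_ad (a b : dual h) x y :
  root_vector ad a x -> root_vector ad b y -> root_vector ad (a + b) (ad x y).
Proof.
move=> ax b_y t; rewrite (ad_derivation ad_lie) ax b_y.
by rewrite !linearZ /= scale_lfunE -scalerDl add_lfunE.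
Qed.

Lemma root_vectorZ (a : dual h) c x :
  root_vector ad a x -> root_vector ad a (c *: x).
Proof. by move=> ax t; rewrite linearZ /= ax !scalerA mulrC. Qed.

Lemma root_vectorB (a : dual h) x y :
  root_vector ad a x -> root_vector ad a y -> root_vector ad a (x - y).
Proof. by move=> ax ay t; rewrite linearB /= ax ay scalerBr. Qed.

Lemma root_vector0P x : root_vector ad (0 : dual h) x <-> x \in h.
Proof.
case: h_cartan => h_comm h_max _; split=> [x0 | xh t].
  apply: h_max => t th; rewrite -(vsprojK th) x0.
  by rewrite zero_lfunE scale0r.
by rewrite h_comm ?subvsP // zero_lfunE scale0r.
Qed.

Lemma root_vectorE (a : dual h) : a \in Omega -> root_vector ad a (E a).
Proof. by case: E_vectors => + _; apply. Qed.

Lemma weight_in (a : dual h) x :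
  root_vector ad a x -> x != 0 -> a != 0 -> a \in Omega.
Proof. by move=> ax x0 a0; apply/Omega_roots; split=> //; exists x. Qed.

Lemma root_vector_eq0 (a : dual h) x :
  root_vector ad a x -> a != 0 -> a \notin Omega -> x = 0.
Proof.
move=> ax a0; apply: contraNeq => x0; exact: weight_in x0 a0.
Qed.

Lemma root_neq0 (a : dual h) : a \in Omega -> a != 0.
Proof. by move/Omega_roots => []. Qed.

Lemma dual_neq0 (a : dual h) : a != 0 -> exists t, a t != 0.
Proof.
move=> a0; apply: contrapT => /forallNP at0; case/eqP: a0.
by apply/lfunP => t; rewrite zero_lfunE; apply/eqP/negP => /negP /at0.
Qed.

Lemma killing_weight (a b : dual h) x y :
  root_vector ad a x -> root_vector ad b y -> a + b != 0 -> killing ad x y = 0.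
Proof.
move=> ax b_y /dual_neq0[t]; rewrite add_lfunE => abt.
have : (a t + b t) * killing ad x y = 0.
  rewrite mulrDl -killingZl -ax (killingC _ x y) -killingZl -b_y.
  rewrite (killingC _ _ x) -killing_invariant; last exact: ad_lie.
  by rewrite (ad_anti ad_lie x) killingNl subrr.
by move=> /eqP; rewrite mulf_eq0 (negPf abt) => /eqP.
Qed.

(** The kernel of [ad] is an ideal, and it is proper because the bracket is nonzero. *)
Lemma center_eq0 z : ad z = 0 -> z = 0.
Proof.
case: g_simple => _ [x [y xy0]] /(_ (lker ad)) simple adz.
have [x' u|ker0|kerT] := simple.
- rewrite !memv_ker => /eqP u0; rewrite (ad_bracket ad_lie) u0.
  by rewrite comp_lfun0l comp_lfun0r subrr.
- by apply/eqP; rewrite -memv0 -ker0 memv_ker adz.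
have : x \in lker ad by rewrite kerT memvf.
by rewrite memv_ker => /eqP ax0; rewrite ax0 zero_lfunE eqxx in xy0.
Qed.

Lemma weight_span_ind (P : g -> Prop) :
  P 0 -> (forall c x y, P x -> P y -> P (c *: x + y)) ->
  (forall (a : dual h) x, root_vector ad a x -> P x) -> forall x, P x.
Proof.
move=> P0 Plin Pw x; have [s s_basis sw] := weight_basis ad_lie h_cartan.
have : x \in <<in_tuple s>>%VS by rewrite /= (span_basis s_basis) memvf.
move/coord_span ->; elim/big_rec: _ => // i y _ Py; apply: Plin => //.
by have [a ?] := sw _ (mem_nth 0 (ltn_ord i)); apply: Pw.
Qed.

(* If there were no roots, h would be all of g, and the bracket would vanish. *)
Lemma Omega_neq0 : exists a, a \in Omega.
Proof.
apply: contrapT => /forallNP O0; case: g_simple => _ [x [y xy0]] _.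
have gh z : z \in h.
  elim/weight_span_ind: z => [|c u v uh vh|a u au]; first exact: mem0v.
    by rewrite memvD ?memvZ.
  have [a0|a0] := eqVneq a 0; first by apply/root_vector0P; rewrite -a0.
  have [->|u0] := eqVneq u 0; first exact: mem0v.
  by case: (O0 a); apply: weight_in u0 a0.
by case: h_cartan => h_comm _ _; rewrite h_comm ?gh ?eqxx in xy0.
Qed.

(* The radical of the Killing form is an ideal; it is not g since
   (E_a, E_{- a}) = 1, so that Cartan's criterion is not needed below. *)
Definition killing_form (x : g) : 'Hom(g, R[i]^o) :=
  linfun (killing ad x : g -> R[i]^o).

Lemma killing_formE x y : killing_form x y = killing ad x y.
Proof. by rewrite lfunE. Qed.

Lemma killing_form_linear : linear killing_form.
Proof.
move=> c x y; apply/lfunP => z; rewrite add_lfunE scale_lfunE !lfunE /=.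
by rewrite !(killingC _ _ z) linearP.
Qed.

HB.instance Definition _ := GRing.isSemilinear.Build R[i] g 'Hom(g, R[i]^o) _
  killing_form (GRing.semilinear_linear killing_form_linear).

Lemma killing_nondegenerate x :
  (forall (a : dual h) y, root_vector ad a y -> killing ad x y = 0) -> x = 0.
Proof.
move=> xw; have x_ker : x \in lker (linfun killing_form).
  rewrite memv_ker lfunE /=; apply/eqP/lfunP => z; rewrite zero_lfunE lfunE /=.
  elim/weight_span_ind: z => [|c u v xu xv|]; first exact: linear0.
    by rewrite linearP /= xu xv mulr0 addr0.
  exact: xw.
have kerP u : u \in lker (linfun killing_form) -> forall z, killing ad u z = 0.
  rewrite memv_ker lfunE => /eqP/lfunP u0 z.
  by rewrite -killing_formE u0 zero_lfunE.
case: g_simple => _ _ /(_ (lker (linfun killing_form))) [y u /kerP u0|ker0|kerT].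
- rewrite memv_ker lfunE /=; apply/eqP/lfunP => z; rewrite zero_lfunE lfunE /=.
  rewrite (ad_anti ad_lie) killingNl killing_invariant ?u0 ?oppr0 //.
  exact: ad_lie.
- by apply/eqP; rewrite -memv0 -ker0.
have [a aO] := Omega_neq0; case: E_vectors => _ /(_ _ aO) /eqP.
rewrite (kerP (E a)); first by rewrite eq_sym oner_eq0.
by rewrite kerT memvf.
Qed.

(** Otherwise [E a], which is nonzero by its normalization, would be orthogonal to every weight
    vector. *)
Lemma root_opp (a : dual h) : a \in Omega -> - a \in Omega.
Proof.
move=> aO; have [_ /(_ _ aO) Ea1] := E_vectors.
have Ea0 : E a != 0.
  by apply: contra_eq_neq Ea1 => ->; rewrite killing0l eq_sym oner_eq0.
apply: contrapT => naO; case/eqP: Ea0; apply: killing_nondegenerate => b y b_y.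
have [ab0|] := eqVneq (a + b) 0; last first.
  by apply: killing_weight => //; apply: root_vectorE.
have [->|y0] := eqVneq y 0; first exact: linear0.
case: naO; have <- : b = - a by apply/eqP; rewrite -addr_eq0 addrC ab0.
apply: weight_in b_y y0 _; apply: contraTneq aO => b0.
by move: ab0; rewrite b0 addr0 => ->; apply/negP => /root_neq0; rewrite eqxx.
Qed.

(* The element of h representing a with respect to the Killing form. *)
Definition coroot_dir (a : dual h) : subvs_of h :=
  vsproj h (ad (E a) (E (- a))).

Lemma coroot_dirE (a : dual h) : a \in Omega ->
  vsval (coroot_dir a) = ad (E a) (E (- a)).
Proof.
move=> aO; rewrite vsprojK //; apply/root_vector0P; rewrite -(subrr a).
by apply: root_vector_ad; apply: root_vectorE => //; apply: root_opp.
Qed.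

Lemma killing_coroot_dir (a : dual h) (s : subvs_of h) : a \in Omega ->
  killing ad (vsval s) (vsval (coroot_dir a)) = a s.
Proof.
move=> aO; rewrite coroot_dirE // -killing_invariant; last exact: ad_lie.
rewrite root_vectorE // killingZl; case: E_vectors => _ -> //.
exact: mulr1.
Qed.

(** The difference of the two sides has weight 0, and by invariance it is orthogonal to [h];
    nondegeneracy does the rest. *)
Lemma ad_root_opp (a : dual h) x y : a \in Omega ->
  root_vector ad a x -> root_vector ad (- a) y ->
  ad x y = killing ad x y *: vsval (coroot_dir a).
Proof.
move=> aO ax ay; apply/eqP; rewrite -subr_eq0; apply/eqP.
have dh : root_vector ad (0 : dual h)
    (ad x y - killing ad x y *: vsval (coroot_dir a)).
  apply: root_vectorB; first by rewrite -(subrr a); apply: root_vector_ad.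
  by apply: root_vectorZ; apply/root_vector0P; apply: subvsP.
apply: killing_nondegenerate => b z bz.
have [b0|b0] := eqVneq b 0; last by apply: killing_weight dh bz _; rewrite add0r.
have /root_vector0P/vsprojK zh : root_vector ad (0 : dual h) z by rewrite -b0.
rewrite killingC -zh linearB linearZ /= -killing_invariant; last exact: ad_lie.
by rewrite ax killingZl killing_coroot_dir // mulrC subrr.
Qed.

(** The iterates have the weights [r + a *+ k], distinct in characteristic 0, while the weights of
    nonzero vectors lie in the finite set [0 :: Omega]. *)
Lemma ad_nilpotent (a r : dual h) x u : a != 0 ->
  root_vector ad a x -> root_vector ad r u -> u != 0 ->
  exists k, iter k (ad x) u != 0 /\ iter k.+1 (ad x) u = 0.
Proof.
move=> a0 ax ru u0; apply: contrapT => /forallNP nil.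
have uk_neq0 k : iter k (ad x) u != 0.
  by elim: k => // k IHk; apply: contra_notN (nil k) => /eqP.
have uk_weight k : root_vector ad (r + a *+ k) (iter k (ad x) u).
  elim: k => [|k IHk]; first by rewrite addr0.
  by rewrite mulrS addrCA; apply: root_vector_ad.
pose s := [seq r + a *+ k | k <- iota 0 (size (0 :: enum_fset Omega)).+1].
have s_uniq : uniq s.
  rewrite map_inj_uniq ?iota_uniq // => i j /addrI.
  exact: mulrn_inj a0 _ _.
have s_sub : {subset s <= 0 :: enum_fset Omega}.
  move=> _ /mapP[k _ ->]; rewrite inE.
  have [//|rk0] := eqVneq (r + a *+ k) 0.
  exact: weight_in (uk_weight k) (uk_neq0 k) rk0.
by have := uniq_leq_size s_uniq s_sub; rewrite size_map size_iota ltnn.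
Qed.

(* The representation theory of sl_2 without normalization: if
   t = [x, y], then x (y^(k+1) u) = ((k+1) r(t) - k(k+1)/2 a(t)) y^k u, and the
   scalar has to vanish at the last nonzero y^k u. *)
Lemma lowering_string (a r : dual h) x y t u : a != 0 ->
  root_vector ad a x -> root_vector ad (- a) y -> ad x y = vsval t ->
  root_vector ad r u -> u != 0 -> ad y (ad x u) = 0 ->
  exists k : nat, (r t : R[i]) *+ 2 = (a t : R[i]) *+ k.
Proof.
move=> a0 ax ay xyt ru u0 yxu.
have [|k [uk0 uk1]] := ad_nilpotent _ ay ru u0; first by rewrite oppr_eq0.
have uk_weight j : root_vector ad (r - a *+ j) (iter j (ad y) u).
  elim: j => [|j IHj]; first by rewrite subr0.
  by rewrite mulrS opprD addrCA; apply: root_vector_ad.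
have xuk j : ad x (iter j.+1 (ad y) u) =
    ((r t : R[i]) *+ j.+1 - (a t : R[i]) *+ 'C(j.+1, 2)) *: iter j (ad y) u.
  elim: j => [|j IHj]; rewrite iterS (ad_derivation ad_lie) xyt.
    by rewrite ru yxu addr0 subr0.
  rewrite uk_weight IHj linearZ /= -iterS -scalerDl; congr (_ *: _).
  rewrite add_lfunE opp_lfunE mulrn_lfunE (binS j.+1) bin1.
  rewrite (mulrnDr _ 'C(j.+1, 2)) (mulrS _ j.+1) addrACA -opprD.
  by rewrite [in LHS](addrC (_ *+ j.+1)).
exists k; move: (xuk k); rewrite uk1 linear0 => /esym/eqP.
rewrite scaler_eq0 (negPf uk0) orbF subr_eq0 => /eqP rk.
have : ((r t : R[i]) *+ 2 - (a t : R[i]) *+ k) *+ k.+1 = 0.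
  have binE : ('C(k.+1, 2) * 2 = k * k.+1)%N.
    by rewrite mulnC -mul_bin_diag bin1 mulnC.
  by rewrite mulrnBl -!mulrnA (mulnC 2) mulrnA rk -mulrnA binE subrr.
by move/eqP; rewrite mulrn_eq0 /= subr_eq0 => /eqP.
Qed.

(** This is [lowering_string] for [- a], with [x] and [y] exchanged and [t] replaced by [- t]. *)
Lemma raising_string (a r : dual h) x y t u : a != 0 ->
  root_vector ad a x -> root_vector ad (- a) y -> ad x y = vsval t ->
  root_vector ad r u -> u != 0 -> ad x (ad y u) = 0 ->
  exists k : nat, (r t : R[i]) *+ 2 = - (a t : R[i]) *+ k.
Proof.
move=> a0 ax ay xyt ru u0 xyu.
have [|||k] := @lowering_string (- a) r y x (- t) u _ ay _ _ ru u0 xyu.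
- by rewrite oppr_eq0.
- by rewrite opprK.
- by rewrite (ad_anti ad_lie) xyt linearN.
rewrite opp_lfunE !linearN /= opprK => rk; exists k.
by rewrite mulNrn -[in RHS]rk mulNrn opprK.
Qed.

Lemma root_lowering (a r : dual h) u : a \in Omega ->
  root_vector ad r u -> u != 0 -> ad (E (- a)) (ad (E a) u) = 0 ->
  exists k : nat, (r (coroot_dir a) : R[i]) *+ 2 = (a (coroot_dir a) : R[i]) *+ k.
Proof.
move=> aO; apply: lowering_string (root_neq0 aO) (root_vectorE aO) _ _.
  by apply: root_vectorE; apply: root_opp.
by rewrite coroot_dirE.
Qed.

Lemma root_raising (a r : dual h) u : a \in Omega ->
  root_vector ad r u -> u != 0 -> ad (E a) (ad (E (- a)) u) = 0 ->
  exists k : nat, (r (coroot_dir a) : R[i]) *+ 2 = - (a (coroot_dir a) : R[i]) *+ k.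
Proof.
move=> aO; apply: raising_string (root_neq0 aO) (root_vectorE aO) _ _.
  by apply: root_vectorE; apply: root_opp.
by rewrite coroot_dirE.
Qed.

(** If a(t_a) = 0, the last nonzero vector of each string raised by [E a] shows that every weight r
    vanishes at t_a. Then t_a is central, hence 0, although its Killing product with s is a(s). *)
Lemma root_coroot_neq0 (a : dual h) : a \in Omega ->
  (a (coroot_dir a) : R[i]) != 0.
Proof.
move=> aO; apply/eqP => at0; have a0 := root_neq0 aO.
suff /center_eq0 t0 : ad (vsval (coroot_dir a)) = 0.
  have [s /eqP[]] := dual_neq0 a0.
  by rewrite -killing_coroot_dir // t0 linear0.
apply/lfunP; elim/weight_span_ind => [|c u v u0 v0|r u ru].
- by rewrite !linear0.
- by rewrite linearP /= u0 v0 !zero_lfunE scaler0 addr0.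
rewrite ru zero_lfunE; have [->|u0] := eqVneq u 0; first exact: scaler0.
have [k [uk0 uk1]] := ad_nilpotent a0 (root_vectorE aO) ru u0.
have uk_weight : root_vector ad (r + a *+ k) (iter k (ad (E a)) u).
  elim: (k) => [|j IHj]; first by rewrite addr0.
  by rewrite mulrS addrCA; apply: root_vector_ad IHj; apply: root_vectorE.
have [|j] := root_lowering aO uk_weight uk0.
  by rewrite -iterS uk1 linear0.
rewrite add_lfunE mulrn_lfunE at0 !mul0rn addr0 => /eqP.
rewrite mulrn_eq0 /= => /eqP ->.
exact: scale0r.
Qed.

(** The part [u] of [x] orthogonal to [E (- a)] is killed by [E (- a)]. If it were nonzero,
    [root_lowering] for [- a] would give (k + 2) a(t) = 0 at t = t_{-a}. *)
Lemma root_space (a : dual h) x : a \in Omega ->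
  root_vector ad a x -> x = killing ad x (E (- a)) *: E a.
Proof.
move=> aO ax; have [_ E1] := E_vectors; have naO := root_opp aO.
apply/eqP; rewrite -subr_eq0; apply/eqP; set u := x - _.
have au : root_vector ad (- - a) u.
  by rewrite opprK; apply/root_vectorB/root_vectorZ/root_vectorE.
have u_orth : killing ad (E (- a)) u = 0.
  rewrite linearB linearZ /= (killingC _ (E (- a)) (E a)) E1 //.
  by rewrite (killingC _ (E (- a)) x) mulr1 subrr.
apply: contrapT => /eqP u0.
have [|k] := root_lowering naO au u0.
  by rewrite (ad_root_opp naO (root_vectorE naO) au) u_orth scale0r linear0.
rewrite opp_lfunE mulNrn => /esym/eqP; rewrite -subr_eq0 opprK -mulrnDr.
by rewrite mulrn_eq0 (negPf (root_coroot_neq0 naO)) orbF addn2.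
Qed.

Lemma killing_root_vectors (a b : dual h) : a \in Omega -> b \in Omega ->
  killing ad (E a) (E b) = (b == - a)%:R.
Proof.
move=> aO bO; have [->|ba] := eqVneq b (- a); first by case: E_vectors => _ ->.
apply: killing_weight; [exact: root_vectorE|exact: root_vectorE|].
by rewrite addrC addr_eq0.
Qed.

Lemma ad_root_eq0 (a b : dual h) : a \in Omega -> b \in Omega ->
  a + b != 0 -> a + b \notin Omega -> ad (E a) (E b) = 0.
Proof.
move=> aO bO ab0 abO; apply: root_vector_eq0 ab0 abO.
by apply: root_vector_ad; apply: root_vectorE.
Qed.

(** If the bracket vanished, [E b] would be the top and [E (a + b)] the bottom of strings in the
    direction a: 2 b(t_a) = k a(t_a) and 2 (a + b)(t_a) = - j a(t_a), so that (2 + k + j) a(t_a) =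
    0. One-dimensionality of the space of b makes [root_raising] applicable to [E (a + b)]. *)
Lemma ad_root_neq0 (a b : dual h) : a \in Omega -> b \in Omega ->
  a + b \in Omega -> ad (E a) (E b) != 0.
Proof.
move=> aO bO abO; apply/eqP => ab0; have [_ E1] := E_vectors.
have E_neq0 c : c \in Omega -> E c != 0.
  move=> cO; apply: contraTneq (oner_neq0 R[i]) => c0.
  by rewrite -(E1 c cO) c0 killing0l eqxx.
have [|k] := root_lowering aO (root_vectorE bO) (E_neq0 _ bO).
  by rewrite ab0 linear0.
have [|j] := root_raising aO (root_vectorE abO) (E_neq0 _ abO).
  rewrite (@root_space b (ad (E (- a)) _)) ?linearZ /= ?ab0 ?scaler0 //.
  by rewrite -{1}(addKr a b); apply: root_vector_ad; apply: root_vectorE;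
    rewrite ?root_opp.
rewrite add_lfunE mulrnDl => abk bk; have := root_coroot_neq0 aO.
move: abk; rewrite bk mulNrn => /eqP; rewrite -subr_eq0 opprK -!mulrnDr.
by rewrite mulrn_eq0 => /orP[|->].
Qed.

(** The third index, equal to - (a + b) in use, makes the cyclic symmetry a consequence of
    invariance of the Killing form. *)
Definition structure_constant (a b c : dual h) : R[i] :=
  killing ad (ad (E a) (E b)) (E c).

Lemma ad_rootE (a b c : dual h) : a + b + c = 0 -> c \in Omega ->
  a \in Omega -> b \in Omega ->
  ad (E a) (E b) = structure_constant a b c *: E (- c).
Proof.
move=> abc0 cO aO bO; rewrite {1}(@root_space (- c) (ad _ _)) ?opprK ?root_opp //.
have <- : a + b = - c by apply/eqP; rewrite -addr_eq0 abc0.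
by apply: root_vector_ad; apply: root_vectorE.
Qed.

Lemma structure_constant_neq0 (a b c : dual h) : a + b + c = 0 ->
  c \in Omega -> a \in Omega -> b \in Omega -> structure_constant a b c != 0.
Proof.
move=> abc0 cO aO bO; have abc : a + b = - c by apply/eqP; rewrite -addr_eq0 abc0.
have : ad (E a) (E b) != 0 by apply: ad_root_neq0; rewrite ?abc ?root_opp.
by rewrite (ad_rootE abc0) // scaler_eq0 => /norP[].
Qed.

(* If no a + b is a root or zero, the b(t_a) are nonnegative multiples of a(t_a),
   and evaluating the relation at t_a gives a contradiction. *)
Lemma root_sum_eq0 (a : dual h) (s : seq (dual h)) : a \in Omega ->
  {subset s <= Omega} -> a + \sum_(b <- s) b = 0 ->
  exists2 b, b \in s & (a + b == 0) || (a + b \in Omega).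
Proof.
move=> aO sO as0; apply: contrapT => no_b; set t := coroot_dir a.
have [k sk] : exists k : nat,
    ((\sum_(b <- s) b) t : R[i]) *+ 2 = (a t : R[i]) *+ k.
  have : {subset s <= s} by [].
  elim: {1 3}s => [|b s' IHs] sub.
    by exists 0%N; rewrite big_nil zero_lfunE mul0rn.
  have bs : b \in s by apply: sub; rewrite mem_head.
  have [k' sk'] : exists k : nat,
      ((\sum_(b <- s') b) t : R[i]) *+ 2 = (a t : R[i]) *+ k.
    by apply: IHs => c cs; apply: sub; rewrite inE cs orbT.
  have bO := sO _ bs.
  have ab0 : ad (E a) (E b) = 0.
    have /norP[] : ~~ ((a + b == 0) || (a + b \in Omega)).
      by apply: contra_notN no_b => ab; exists b.
    exact: ad_root_eq0.
  have bn0 : E b != 0.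
    apply: contraTneq (oner_neq0 R[i]) => c0; have [_ E1] := E_vectors.
    by rewrite -(E1 b bO) c0 killing0l eqxx.
  have [|j bj] := root_lowering aO (root_vectorE bO) bn0.
    by rewrite ab0 linear0.
  by exists (j + k')%N; rewrite big_cons add_lfunE mulrnDl bj sk' mulrnDr.
have := congr1 (fun c : dual h => (c t : R[i]) *+ 2) as0.
rewrite add_lfunE mulrnDl sk zero_lfunE mul0rn -mulrnDr => /eqP.
by rewrite mulrn_eq0 (negPf (root_coroot_neq0 aO)) orbF.
Qed.

End Roots.

(** * Linear relations between roots *)

Section SpanOfSequences.
Variables (F : fieldType) (V : vectType F).
Implicit Types (s : seq V) (c : V -> F) (v x y : V).

(** Coefficients are functions of the vector, not of its position, hence the assumption [uniq s]. *)
Lemma span_seqP s v : uniq s -> v \in <<s>>%VS ->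
  exists c, v = \sum_(y <- s) c y *: y.
Proof.
elim: s v => [|x s IHs] v.
  rewrite span_nil memv0 => _ /eqP ->; exists (fun=> 0).
  by rewrite big_nil.
rewrite span_cons => /= /andP[xs us] /memv_addP[_ /vlineP[k ->] [w ws ->]].
have [c ->] := IHs w us ws; exists (fun y => if y == x then k else c y).
rewrite big_cons eqxx; congr (_ + _); apply: eq_big_seq => y ys.
by case: eqP => // yx; rewrite -yx ys in xs.
Qed.

Lemma free_seqP s c : free s -> \sum_(y <- s) c y *: y = 0 ->
  forall y, y \in s -> c y = 0.
Proof.
move=> /(@freeP _ _ _ (in_tuple s)) s_free sum0 y /(nthP 0)[i i_s <-].
have := s_free (fun j : 'I_(size s) => c s`_j) _ (Ordinal i_s); apply.
by rewrite -[RHS]sum0 (big_nth 0) big_mkord.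
Qed.

(** Used with [Pi] and [Gamma]: a combination of simple roots lying in the span of [Gamma] involves
    only [Gamma]. *)
Lemma free_sub_coef s s' c : free s -> uniq s' -> {subset s' <= s} ->
  \sum_(y <- s) c y *: y \in <<s'>>%VS ->
  forall y, y \in s -> y \notin s' -> c y = 0.
Proof.
move=> s_free us' s's /(span_seqP us')[d sum_d] y ys ys'.
have : c y - (if y \in s' then d y else 0) = 0.
  apply: (@free_seqP s (fun z => c z - (if z \in s' then d z else 0))) => //.
  under eq_bigr do rewrite scalerBl.
  apply/eqP; rewrite big_split sumrN /= subr_eq0 sum_d.
  have /(perm_big _) -> : perm_eq s' [seq z <- s | z \in s'].
    apply: uniq_perm => // [|z]; first by rewrite filter_uniq ?free_uniq.
    by rewrite mem_filter andb_idr //; apply: s's.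
  rewrite big_filter big_mkcond; apply/eqP/eq_bigr => z _ /=.
  by case: ifP => // _; rewrite scale0r.
by rewrite (negPf ys') subr0.
Qed.

End SpanOfSequences.

(** * Descent from complex to rational relations *)

Section Integrality.
Variables (F : numFieldType) (V : vectType F) (p : seq V).
Hypothesis p_free : free p.

Definition integral_comb (v : V) := exists z : V -> int, v = \sum_(y <- p) y *~ z y.

Lemma integral_combD u v :
  integral_comb u -> integral_comb v -> integral_comb (u + v).
Proof.
move=> [z ->] [z' ->]; exists (fun y => z y + z' y).
by rewrite -big_split; apply: eq_bigr => y _; rewrite mulrzDr.
Qed.

Lemma integral_comb_sum s : (forall y, y \in s -> integral_comb y) ->
  integral_comb (\sum_(y <- s) y).
Proof.
move=> s_int; rewrite big_seq; apply: big_ind => [||y /s_int //].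
  by exists (fun=> 0); rewrite big1.
exact: integral_combD.
Qed.

(* An integral vector in the span of integral vectors is a rational combination
   of them, because ranks do not change under extension of scalars. *)
Lemma rational_relation s x : uniq s ->
  (forall y, y \in s -> integral_comb y) -> integral_comb x ->
  x \in <<s>>%VS ->
  exists n (e : V -> int), x *+ n.+1 = \sum_(y <- s) y *~ e y.
Proof.
move=> us s_int [zx x_int] /(span_seqP us)[c x_c].
have [z z_int] : exists z : V -> V -> int,
    forall y, y \in s -> y = \sum_(w <- p) w *~ z y w.
  have /choice[z zP] (y : V) : exists z : V -> int,
      y \in s -> y = \sum_(w <- p) w *~ z w.
    by have [/s_int[z]|] := boolP (y \in s); [exists z | exists (fun=> 0)].
  by exists z.
pose A := \matrix_(i < size s, j < size p) (z s`_i p`_j)%:~R : 'M[rat]_(_, _).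
pose X := \row_(j < size p) (zx p`_j)%:~R : 'rV[rat]_(_).
(* The coefficients [c] solve the linear system over [F]; comparing coordinates is legitimate
   because [p] is free. Afterwards [map_submx] yields a rational solution [D]. *)
have : (map_mx (ratr : rat -> F) X <= map_mx (ratr : rat -> F) A)%MS.
  apply/submxP; exists (\row_i c s`_i); apply/rowP => j; rewrite !mxE ratr_int.
  under eq_bigr do rewrite !mxE ratr_int.
  apply/eqP; rewrite -subr_eq0; apply/eqP.
  pose f w : F := (zx w)%:~R - \sum_(y <- s) c y * (z y w)%:~R.
  have -> : \sum_(i < size s) c s`_i * (z s`_i p`_j)%:~R =
            \sum_(y <- s) c y * (z y p`_j)%:~R by rewrite (big_nth 0) big_mkord.
  apply: (@free_seqP _ _ p f p_free); last by rewrite mem_nth.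
  under eq_bigr do rewrite scalerBl scaler_suml.
  rewrite big_split sumrN /= exchange_big /=; apply/eqP; rewrite subr_eq0.
  under eq_bigr do rewrite scaler_int; rewrite -x_int x_c; apply/eqP.
  apply: eq_big_seq => y ys; rewrite [X in c y *: X](z_int _ ys) scaler_sumr.
  by apply: eq_bigr => w _; rewrite -scaler_int scalerA.
(* The product [n] of the denominators clears all of them, and [e] is n times the rational solution,
   reindexed by vectors; n > 0 gives the form [n.+1] of the statement. *)
rewrite map_submx => /submxP[D XD].
pose d i := D 0 i; pose n := (\prod_(i < size s) `|denq (d i)|)%N.
have n_gt0 : (0 < n)%N by rewrite prodn_gt0 // => i; rewrite absz_gt0 denq_neq0.
have /choice[e eP] (y : V) : exists e : int,
    forall i : 'I_(size s), s`_i = y -> d i * n%:R = e%:~R.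
  have [ys|ys] := boolP (y \in s); last first.
    by exists 0 => i iy; rewrite -iy mem_nth in ys.
  have /(nthP 0)[k ks ky] := ys; pose i := Ordinal ks.
  exists (numq (d i) * (\prod_(j < size s | j != i) `|denq (d j)|)%N%:Z) => j.
  move=> jy; have -> : j = i.
    by apply/val_inj/eqP; rewrite -(nth_uniq 0 (ltn_ord j) ks us) jy ky.
  rewrite /n (bigD1 i) //= natrM mulrA intrM; congr (_ * _).
  by rewrite -{1}[d i]divq_num_den pmulrn absz_denq divfK // intr_eq0 denq_neq0.
have zxE w : w \in p -> zx w *+ n = \sum_(y <- s) e y * z y w.
  move=> /(nthP 0)[k kp <-]; apply: (@intr_inj rat); pose j := Ordinal kp.
  have /rowP/(_ j) := XD; rewrite !mxE /= => XDj.
  rewrite rmorphMn /= XDj -mulr_natr mulr_suml rmorph_sum /= (big_nth 0) big_mkord.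
  apply: eq_bigr => i _; rewrite !mxE mulrAC intrM; congr (_ * _).
  exact: eP.
exists n.-1, e; rewrite prednK // x_int -sumrMnl.
have -> : \sum_(y <- s) y *~ e y = \sum_(y <- s) \sum_(w <- p) w *~ (e y * z y w).
  apply: eq_big_seq => y ys; rewrite [X in X *~ _](z_int _ ys) mulrz_suml.
  by apply: eq_bigr => w _; rewrite mulrC mulrzA.
rewrite exchange_big; apply: eq_big_seq => w wp.
by rewrite -mulrz_sumr -zxE // -mulr_natr natz mulrzA pmulrn.
Qed.

End Integrality.

(** * Integral combinations as sums over a symmetric set *)

Section RootSums.
Variables (V : zmodType) (L : {pred V}).
Hypothesis L_opp : forall y, y \in L -> - y \in L.

Definition sum_in (v : V) :=
  exists2 s : seq V, {subset s <= L} & v = \sum_(y <- s) y.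

Lemma sum_in0 : sum_in 0.
Proof. by exists [::]; rewrite ?big_nil. Qed.

Lemma sum_inD u v : sum_in u -> sum_in v -> sum_in (u + v).
Proof.
move=> [s sL ->] [s' s'L ->]; exists (s ++ s'); last by rewrite big_cat.
by move=> y; rewrite mem_cat => /orP[/sL|/s'L].
Qed.

Lemma sum_inN v : sum_in v -> sum_in (- v).
Proof.
move=> [s sL ->]; exists [seq - y | y <- s]; last by rewrite big_map sumrN.
by move=> _ /mapP[y /sL yL ->]; apply: L_opp.
Qed.

(** Repetition and change of sign turn integral combinations into plain sums, the form of relation
    to which the combinatorial property of roots applies. *)
Lemma sum_in_int (I : Type) (r : seq I) (P : pred I) (f : I -> V) (e : I -> int) :
  (forall i, P i -> f i \in L) -> sum_in (\sum_(i <- r | P i) f i *~ e i).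
Proof.
move=> fL; apply: big_ind => [||i /fL fi]; [exact: sum_in0|exact: sum_inD|].
have nat_mul n : sum_in (f i *+ n).
  elim: n => [|n IHn]; first exact: sum_in0.
  rewrite mulrS; apply: sum_inD IHn; exists [:: f i]; last by rewrite big_seq1.
  by move=> y; rewrite inE => /eqP ->.
by case: (e i) => n; rewrite ?NegzE ?mulrNz -pmulrn //; apply: sum_inN.
Qed.

End RootSums.

(** * Parabolic subsets and lifting of relations *)

Section RootCombinatorics.
Variables (F : numFieldType) (V : vectType F) (Omega Pi : {fset V}).
Hypothesis Omega_opp : forall a, a \in Omega -> - a \in Omega.
Hypothesis Omega_sum : forall a (s : seq V), a \in Omega ->
  {subset s <= Omega} -> a + \sum_(b <- s) b = 0 ->
  exists2 b, b \in s & (a + b == 0) || (a + b \in Omega).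
Hypothesis Pi_free : free (enum_fset Pi).
Hypothesis Pi_sub : {subset Pi <= Omega}.
Hypothesis Omega_int :
  forall a, a \in Omega -> integral_comb (enum_fset Pi) a.

(* Adding one of the remaining roots to the first one gives a root or zero, so
   that the relation becomes shorter. *)
Lemma closed_relation (T : {pred V}) (s : seq V) :
  (forall a b, a \in Omega -> b \in Omega -> a \in T -> b \in T ->
     a + b \in Omega -> a + b \in T) ->
  {subset s <= Omega} -> {subset s <= T} -> \sum_(b <- s) b = 0 ->
  forall a, a \in s -> - a \in T.
Proof.
move=> T_closed; have [n] := ubnP (size s); elim: n s => // n IHn [//|a s] /=.
rewrite ltnS => s_n sO sT; rewrite big_cons => sum0.
have aO : a \in Omega by apply: sO; rewrite mem_head.
have aT : a \in T by apply: sT; rewrite mem_head.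
have s'O : {subset s <= Omega} by move=> y ys; apply: sO; rewrite inE ys orbT.
have s'T : {subset s <= T} by move=> y ys; apply: sT; rewrite inE ys orbT.
have [b bs ab] := Omega_sum aO s'O sum0.
have [bO bT] := (s'O _ bs, s'T _ bs).
have remO : {subset rem b s <= Omega} by move=> y /mem_rem /s'O.
have remT : {subset rem b s <= T} by move=> y /mem_rem /s'T.
have s_gt0 : (0 < size s)%N by case: (s) bs.
have mem_s y : y \in s -> (y == b) || (y \in rem b s).
  by rewrite (perm_mem (perm_to_rem bs)) inE.
move: sum0; rewrite (perm_big _ (perm_to_rem bs)) big_cons addrA => sum0.
have [ab0|abn0] := eqVneq (a + b) 0.
  have bE : b = - a by apply/eqP; rewrite -addr_eq0 addrC ab0.
  move=> c; rewrite inE => /predU1P[->|/mem_s/predU1P[->|cs]].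
  - by rewrite -bE.
  - by rewrite bE opprK.
  apply: (IHn (rem b s)) => //; last by rewrite ab0 add0r in sum0.
  by rewrite size_rem // (leq_ltn_trans (leq_pred _)).
move: ab; rewrite (negPf abn0) /= => abO.
have negT : forall c, c \in a + b :: rem b s -> - c \in T.
  apply: IHn => [|y|y|]; last by rewrite big_cons.
  - by rewrite /= size_rem // prednK.
  - by rewrite inE => /predU1P[->|/remO].
  by rewrite inE => /predU1P[->|/remT] //; apply: T_closed.
have nabT : - (a + b) \in T by rewrite negT // mem_head.
have nabO := Omega_opp abO.
(* By induction - (a + b) is in T. Adding b or a, which are in T, leads to the roots - a and - b. *)
have naE : - a = - (a + b) + b by rewrite opprD subrK.
have nbE : - b = - (a + b) + a by rewrite opprD addrC addrA subrr add0r.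
move=> c; rewrite inE => /predU1P[->|/mem_s/predU1P[->|cs]].
- by rewrite naE T_closed // -naE Omega_opp.
- by rewrite nbE T_closed // -nbE Omega_opp.
by rewrite negT // inE cs orbT.
Qed.

(** By [rational_relation], a positive multiple of the sum is an integral combination of the
    symmetric set [L], so a sum of elements of [L] cancels it. Then [closed_relation] applies to the
    corresponding number of copies of [s] together with these elements. *)
Lemma parabolic_relation (T : {pred V}) (s : seq V) :
  (forall a b, a \in Omega -> b \in Omega -> a \in T -> b \in T ->
     a + b \in Omega -> a + b \in T) ->
  {subset s <= Omega} -> {subset s <= T} ->
  \sum_(b <- s) b \in
    <<[seq a <- enum_fset Omega | (a \in T) && (- a \in T)]>>%VS ->
  forall a, a \in s -> - a \in T.
Proof.
move=> T_closed sO sT; set L := filter _ _ => sL.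
have LP y : y \in L -> [/\ y \in Omega, y \in T & - y \in T].
  by rewrite mem_filter => /andP[/andP[]].
have L_opp y : y \in L -> - y \in L.
  move=> /LP[yO yT nyT]; rewrite mem_filter nyT opprK yT.
  exact: Omega_opp.
have [||||n [e sum_e]] := rational_relation (p := enum_fset Pi) _ (s := L) _ _ _ sL.
- exact: Pi_free.
- by rewrite filter_uniq // fset_uniq.
- by move=> y /LP[/Omega_int].
- by apply: integral_comb_sum => y /sO; apply: Omega_int.
have [s' s'L sum_s'] : sum_in [in L] (- \sum_(y <- L) y *~ e y).
  by apply: sum_inN => //; rewrite big_seq; apply: sum_in_int.
have sum_nseq m : \sum_(y <- flatten (nseq m s)) y = (\sum_(y <- s) y) *+ m.
  by elim: m => [|m IHm]; rewrite ?big_nil // big_cat IHm mulrS.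
move=> a a_s; apply: (closed_relation (s := flatten (nseq n.+1 s) ++ s')) => //.
- move=> y; rewrite mem_cat => /orP[|/s'L/LP[]//].
  by move=> /flattenP[_ /nseqP[-> _] /sO].
- move=> y; rewrite mem_cat => /orP[|/s'L/LP[]//].
  by move=> /flattenP[_ /nseqP[-> _] /sT].
- by rewrite big_cat sum_nseq -sum_s' /= -sum_e subrr.
by rewrite mem_cat /= mem_cat a_s.
Qed.

(** Take [d] off [s]: by [Omega_sum] it can be added to one of the other terms of the relation.
    Added to a, b or c it gives a root, not 0, since these lie outside [W], and the class modulo [W]
    is unchanged; added to a term of [s] it merges with it or cancels it. In each case [s] becomes
    shorter. *)
Lemma lift_triple (W : {vspace V}) (s : seq V) (a b c : V) :
  {subset s <= Omega} -> {subset s <= W} ->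
  a \in Omega -> b \in Omega -> c \in Omega ->
  a \notin W -> b \notin W -> c \notin W ->
  a + b + c + \sum_(d <- s) d = 0 ->
  exists a' b' c', [/\ a' \in Omega, b' \in Omega & c' \in Omega] /\
    [/\ a' - a \in W, b' - b \in W, c' - c \in W & a' + b' + c' = 0].
Proof.
have [n] := ubnP (size s); elim: n s a b c => // n IHn [|d s] a b c /=.
  rewrite big_nil addr0 => _ _ _ aO bO cO _ _ _ abc0; exists a, b, c.
  by rewrite !subrr !mem0v.
rewrite ltnS => s_n sO sW aO bO cO aW bW cW.
rewrite big_cons => sum0.
have dO : d \in Omega by apply: sO; rewrite mem_head.
have dW : d \in W by apply: sW; rewrite mem_head.
have s'O : {subset s <= Omega} by move=> y ys; apply: sO; rewrite inE ys orbT.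
have s'W : {subset s <= W} by move=> y ys; apply: sW; rewrite inE ys orbT.
have addW x : (d + x \in W) = (x \in W) by rewrite rpredDl.
have step x : x \in Omega -> x \notin W -> (d + x == 0) || (d + x \in Omega) ->
    d + x \in Omega.
  by move=> xO; rewrite -addW => xW /orP[/eqP x0|//]; rewrite x0 mem0v in xW.
have shift x x' : x' - (d + x) \in W -> x' - x \in W.
  by rewrite opprD addrCA -opprB rpredBl // rpredN.
have [||y] := Omega_sum dO (s := [:: a, b, c & s]).
- by move=> y; rewrite !inE => /or4P[/eqP->|/eqP->|/eqP->|/s'O].
- by apply: etrans sum0; rewrite !big_cons [RHS]addrCA -!addrA.
have {}sum0 : d + (a + b + c + \sum_(j <- s) j) = 0 by rewrite addrCA.
rewrite !inE => /or4P[/eqP->|/eqP->|/eqP->|ys].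
- move=> /(step _ aO aW) daO.
  have [||a' [b' [c' [? [a'a ? ? ?]]]]] :=
    IHn s (d + a) b c s_n s'O s'W daO bO cO _ bW cW.
  + by rewrite addW.
  + by apply: etrans sum0; rewrite !addrA.
  by exists a', b', c'; split => //; split => //; apply: shift a'a.
- move=> /(step _ bO bW) dbO.
  have [||a' [b' [c' [? [? b'b ? ?]]]]] :=
    IHn s a (d + b) c s_n s'O s'W aO dbO cO aW _ cW.
  + by rewrite addW.
  + by apply: etrans sum0; rewrite !addrA [d + a]addrC.
  by exists a', b', c'; split => //; split => //; apply: shift b'b.
- move=> /(step _ cO cW) dcO.
  have [||a' [b' [c' [? [? ? c'c ?]]]]] :=
    IHn s a b (d + c) s_n s'O s'W aO bO dcO aW bW.
  + by rewrite addW.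
  + apply: etrans sum0; rewrite !addrA; congr (_ + _ + _).
    by rewrite [LHS]addrC addrA.
  by exists a', b', c'; split => //; split => //; apply: shift c'c.
have s_gt0 : (0 < size s)%N by case: (s) ys.
have remO : {subset rem y s <= Omega} by move=> z /mem_rem /s'O.
have remW : {subset rem y s <= W} by move=> z /mem_rem /s'W.
move: sum0; rewrite addrCA (perm_big _ (perm_to_rem ys)) big_cons.
rewrite [d + (y + _)]addrA => sum0; case/orP => [/eqP dy0|dyO].
  apply: (IHn (rem y s)) => //; last by rewrite dy0 add0r in sum0.
  by rewrite size_rem // (leq_ltn_trans (leq_pred _)).
apply: (IHn (d + y :: rem y s)) => // [|z|z|]; last by rewrite big_cons.
- by rewrite /= size_rem // prednK.
- by rewrite inE => /predU1P[->|/remO].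
by rewrite inE => /predU1P[->|/remW] //; rewrite addW s'W.
Qed.

End RootCombinatorics.

(** * Functional equations of psi and values extended by zero *)

Lemma psiV (R : realType) (l : R[i]) : l != 0 -> l != 1 -> psi l^-1 = - psi l.
Proof.
move=> l0 l1; rewrite /psi; field.
by rewrite l0 mulN1r !subr_eq0 [1 == l]eq_sym (negPf l1).
Qed.

(** For l = exp(2 x), [psi l] is coth x, and this is the addition formula of the hyperbolic
    cotangent. *)
Lemma psiM (R : realType) (k l : R[i]) : k != 1 -> l != 1 -> k * l != 1 ->
  psi (k * l) * (psi k + psi l) = psi k * psi l + 1.
Proof.
by move=> k1 l1 kl1; rewrite /psi; field; rewrite !subr_eq0 k1 l1 kl1.
Qed.

Lemma in_fset_filter (T : choiceType) (A : {fset T}) (P : pred T) x :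
  (x \in [fset y in A | P y]%fset) = (x \in A) && P x.
Proof. by rewrite !inE. Qed.

Lemma mem_lker_qproj (F : fieldType) (V : vectType F) (W : {vspace V}) v :
  (qproj W v == 0) = (v \in W).
Proof. by rewrite -memv_ker lker_qproj. Qed.

Lemma ext0E (T : choiceType) (R : nmodType) (A : {fset T}) (c : A -> R) (a : A) :
  ext0 c (val a) = c a.
Proof. by rewrite /ext0 valK. Qed.

Lemma ext0_in (T : choiceType) (R : nmodType) (A : {fset T}) (c : A -> R) x
  (xA : x \in A) : ext0 c x = c [` xA]%fset.
Proof. by rewrite /ext0 insubT. Qed.

Lemma ext0_out (T : choiceType) (R : nmodType) (A : {fset T}) (c : A -> R) x :
  x \notin A -> ext0 c x = 0.
Proof. by move=> xA; rewrite /ext0 insubN. Qed.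

(** * Strata *)

(* For U the quotient h^*/h^*_Gamma, Q the set of quasiroots and p the map pi, the
   predicates of this section are those of the theorem. *)
Section Strata.
Variables (R : realType) (U U' : vectType R[i]) (Q : {fset U}) (K : R[i]).
Hypothesis Q_opp : forall x, (- x \in Q) = (x \in Q).

(* The equation of the variety for the triple x, y, - (x + y), in a form which is
   symmetric in x, y, z and, for odd c, invariant under the change of sign. *)
Definition Z_relation (c : {ffun Q -> R[i]}) x y z : Prop :=
  ext0 c x * ext0 c y + ext0 c y * ext0 c z + ext0 c z * ext0 c x + K ^+ 2 = 0.

Lemma Z_relationC c x y z : Z_relation c x y z -> Z_relation c y z x.
Proof. by rewrite /Z_relation => <-; ring. Qed.

Definition odd_on (c : {ffun Q -> R[i]}) : Prop :=
  forall a b : Q, val b = - val a -> c b = - c a.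

Definition Z_on (c : {ffun Q -> R[i]}) : Prop :=
  odd_on c /\ (forall x y z, x \in Q -> y \in Q -> z \in Q -> x + y + z = 0 ->
    Z_relation c x y z).

Lemma ext0_odd (c : {ffun Q -> R[i]}) x :
  odd_on c -> ext0 c (- x) = - ext0 c x.
Proof.
move=> c_odd; have [xQ|xQ] := boolP (x \in Q); last first.
  by rewrite !ext0_out ?oppr0 // Q_opp.
have nxQ : - x \in Q by rewrite Q_opp.
by rewrite !ext0_in; apply: c_odd.
Qed.

Lemma Z_relationN c x y z :
  odd_on c -> Z_relation c (- x) (- y) (- z) -> Z_relation c x y z.
Proof. by move=> c_odd; rewrite /Z_relation !ext0_odd // => <-; ring. Qed.

Variable p : 'Hom(U, U').

Definition image_set : {fset U'} := ([fset p x | x in Q] `\ 0)%fset.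

Lemma image_setP x : x \in image_set <-> x != 0 /\ exists2 a, a \in Q & x = p a.
Proof.
rewrite in_fsetD1; split=> [/andP[x0 /imfsetP[a aQ xa]]|[x0 [a aQ xa]]].
  by split=> //; exists a.
by rewrite x0 xa; apply: in_imfset.
Qed.

Definition semilinear_in (X : {fset U'}) : Prop :=
  [/\ (X `<=` image_set)%fset,
      forall x1 x2, x1 \in X -> x2 \in X ->
        x1 + x2 \in image_set -> x1 + x2 \in X,
      (X `&` [fset - x | x in X])%fset = fset0 &
      (X `|` [fset - x | x in X])%fset = image_set].

Definition corresponds_in (O' : {fset U}) (X : {fset U'})
    (lambda : {ffun O' -> R[i]}) (c : {ffun Q -> R[i]}) : Prop :=
  [/\ forall (a : Q) (a' : O'), val a' = val a -> c a = K * psi (lambda a'),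
      forall a : Q, p (val a) \in X -> c a = K &
      forall a : Q, - p (val a) \in X -> c a = - K].

Definition multiplicative_in (O' : {fset U}) (lambda : {ffun O' -> R[i]}) : Prop :=
  [/\ forall a, lambda a != 0,
      forall a b s : O', val s = val a + val b ->
        lambda s = lambda a * lambda b &
      forall a b : O', val b = - val a -> lambda b = (lambda a)^-1].

Definition regular_in (O' : {fset U}) (lambda : {ffun O' -> R[i]}) : Prop :=
  (forall a, lambda a != 1) /\
  (forall a b s : O', val s = val a + val b -> lambda a * lambda b = 1 ->
     val a = - val b).

Section Data.
Variables (O' : {fset U}) (X : {fset U'}).
Hypothesis mem_linear : forall x, (x \in O') = (x \in Q) && (p x == 0).
Hypothesis X_semilinear : semilinear_in X.

Lemma mem_image_set x :
  x \in Q -> x \notin O' -> p x \in image_set.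
Proof.
move=> xQ; rewrite mem_linear xQ /= => px.
by rewrite in_fsetD1 px; apply: in_imfset.
Qed.

Lemma semilinear_neq0 y : y \in X -> y != 0.
Proof.
have [/fsubsetP X_pi _ _ _] := X_semilinear.
by move=> /X_pi; rewrite in_fsetD1 => /andP[].
Qed.

Lemma semilinear_opp y : y \in X -> - y \notin X.
Proof.
have [_ _ X_disj _] := X_semilinear => yX; apply/negP => nyX.
have : y \in (X `&` [fset - x | x in X])%fset.
  by rewrite in_fsetI yX /= -(opprK y); apply: (in_imfset _ (fun x => - x)).
by rewrite X_disj.
Qed.

Lemma semilinear_total x : x \in Q -> x \notin O' -> p x \in X \/ - p x \in X.
Proof.
move=> xQ xO'; have := mem_image_set xQ xO'.
have [_ _ _ XU] := X_semilinear.
rewrite -XU in_fsetU => /orP[|/imfsetP[y yX ->]].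
  by left.
by right; rewrite opprK.
Qed.

Lemma corr_unique (lambda : {ffun O' -> R[i]}) (c c' : {ffun Q -> R[i]}) :
  corresponds_in X lambda c -> corresponds_in X lambda c' -> c = c'.
Proof.
move=> [cO cX cN] [cO' cX' cN']; apply/ffunP => a.
have [aO'|aO'] := boolP (val a \in O').
  by rewrite (cO a [` aO']%fset) // (cO' a [` aO']%fset).
have [aX|aX] := semilinear_total (valP a) aO'; first by rewrite cX ?cX'.
by rewrite cN ?cN'.
Qed.

(** If all three terms are in [O'], this is [psiM]. If just one is, the other two have opposite
    images, hence opposite values with square K^2, and the relation cancels. If none is, the values
    are K or - K and only three equal signs are a danger; these contradict the closedness of [X]
    under sums, since p x + p y = - p z. *)
Lemma corr_Z (lambda : {ffun O' -> R[i]}) (c : {ffun Q -> R[i]}) :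
  multiplicative_in lambda -> regular_in lambda ->
  corresponds_in X lambda c -> Z_on c.
Proof.
move=> [l0 lM lV] [l1 _] [cO cX cN].
have cO_ext x (xO' : x \in O') : ext0 c x = K * psi (lambda [` xO']%fset).
  have xQ : x \in Q by move: xO'; rewrite mem_linear => /andP[].
  by rewrite (ext0_in _ xQ); apply: cO.
have cX_ext x : x \in Q -> p x \in X -> ext0 c x = K.
  by move=> xQ xX; rewrite (ext0_in _ xQ); apply: cX.
have cN_ext x : x \in Q -> - p x \in X -> ext0 c x = - K.
  by move=> xQ xX; rewrite (ext0_in _ xQ); apply: cN.
have O'N x : x \in O' -> - x \in O'.
  by rewrite !mem_linear Q_opp linearN oppr_eq0.
have extN x : x \in Q -> ext0 c (- x) = - ext0 c x.
  move=> xQ; have nxQ : - x \in Q by rewrite Q_opp.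
  have [xO'|xO'] := boolP (x \in O').
    rewrite !cO_ext; first exact: O'N.
    move=> nxO'; rewrite (lV [` xO']%fset [` nxO']%fset) // psiV //.
    exact: mulrN.
  have [xX|xX] := semilinear_total xQ xO'.
    by rewrite (cX_ext x) // cN_ext // linearN opprK.
  by rewrite (cN_ext x) // cX_ext ?opprK // linearN.
split=> [a b ab|x y z xQ yQ zQ xyz].
  by have := extN _ (valP a); rewrite -ab !ext0E.
have rel_O' u v w : u \in Q -> v \in Q -> w \in Q -> u + v + w = 0 ->
    u \in O' -> Z_relation c u v w.
  move=> uQ vQ wQ uvw uO'; have pu : p u = 0.
    by apply/eqP; move: uO'; rewrite mem_linear => /andP[].
  have pw : p w = - p v.
    apply/eqP; rewrite -addr_eq0 addrC; apply/eqP.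
    by have := congr1 p uvw; rewrite !linearD linear0 /= pu add0r.
  have [vO'|vO'] := boolP (v \in O').
    have wO' : w \in O'.
      by move: vO'; rewrite !mem_linear wQ pw oppr_eq0 vQ.
    have nwO' := O'N _ wO'.
    have uvE : - w = u + v by apply/eqP; rewrite eq_sym -addr_eq0 uvw.
    have luv := lM [` uO']%fset [` vO']%fset [` nwO']%fset uvE.
    have uv1 : lambda [` uO']%fset * lambda [` vO']%fset != 1 by rewrite -luv.
    have := psiM (l1 _) (l1 _) uv1; rewrite -luv => psi_rel.
    have := cO_ext _ nwO'; rewrite extN // => /(canRL (@opprK _)) cw.
    rewrite /Z_relation cw !cO_ext.
    set lu := lambda [` uO']%fset; set lv := lambda [` vO']%fset.
    rewrite -[RHS](mulr0 (- K ^+ 2)) -[in RHS](subrr (psi lu * psi lv + 1)).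
    by rewrite -[in X in X - _]psi_rel; ring.
  have cwv : ext0 c w = - ext0 c v.
    have [vX|vX] := semilinear_total vQ vO'.
      by rewrite (cX_ext v) // cN_ext // pw opprK.
    by rewrite (cN_ext v) // cX_ext ?opprK // pw.
  have cv2 : ext0 c v ^+ 2 = K ^+ 2.
    have [vX|vX] := semilinear_total vQ vO'.
      by rewrite (cX_ext v).
    by rewrite (cN_ext v) // sqrrN.
  by rewrite /Z_relation cwv -cv2; ring.
have [xO'|xO'] := boolP (x \in O'); first exact: rel_O'.
have [yO'|yO'] := boolP (y \in O').
  do 2 apply: Z_relationC; apply: rel_O' => //.
  by rewrite addrC addrA.
have [zO'|zO'] := boolP (z \in O').
  apply: Z_relationC; apply: rel_O' => //.
  by rewrite -addrA addrC.
have not_all_X u v w : u \in Q -> v \in Q -> w \in Q -> u + v + w = 0 ->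
    w \notin O' -> p u \in X -> p v \in X -> p w \in X -> False.
  move=> uQ vQ wQ uvw wO' uX vX wX.
  have uvE : p u + p v = p (- w).
    by rewrite -linearD; congr (p _); apply/eqP; rewrite -addr_eq0 uvw.
  case: X_semilinear => _ X_add _ _; have := X_add _ _ uX vX.
  rewrite uvE mem_image_set ?Q_opp // => [/(_ isT)|].
    by rewrite linearN; apply/negP; apply: semilinear_opp.
  by apply: contra wO' => /O'N; rewrite opprK.
have valueP u : u \in Q -> u \notin O' ->
    ext0 c u = K /\ p u \in X \/ ext0 c u = - K /\ - p u \in X.
  by move=> uQ uO'; have [uX|uX] := semilinear_total uQ uO'; [left|right]; auto.
rewrite /Z_relation; have [[-> xX]|[-> xX]] := valueP x xQ xO';
  have [[-> yX]|[-> yX]] := valueP y yQ yO';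
  have [[-> zX]|[-> zX]] := valueP z zQ zO'; try by ring.
  by case: (@not_all_X x y z).
case: (@not_all_X (- x) (- y) (- z)); rewrite ?Q_opp ?linearN //.
  by rewrite -!opprD xyz oppr0.
by apply: contra zO' => /O'N; rewrite opprK.
Qed.

Lemma corr_exists (lambda : {ffun O' -> R[i]}) :
  exists c : {ffun Q -> R[i]}, corresponds_in X lambda c.
Proof.
exists [ffun a : Q => if insub (val a) is Some a' then K * psi (lambda a')
  else if p (val a) \in X then K else - K].
split=> a; rewrite ffunE.
- by move=> a' <-; rewrite valK.
- move=> aX; rewrite aX insubN // mem_linear (valP a).
  exact: semilinear_neq0.
move=> aX; rewrite insubN; last first.
  by rewrite mem_linear (valP a) /= -oppr_eq0 semilinear_neq0.
by rewrite ifN // -[p _]opprK semilinear_opp.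
Qed.

End Data.

End Strata.

(** * The stratum containing a given point *)

Section Decomposition.
Variables (R : realType) (U U' : vectType R[i]) (Q : {fset U}) (K : R[i]).
Hypothesis Q_opp : forall x, (- x \in Q) = (x \in Q).
Hypothesis K_neq0 : K != 0.

Lemma K_neq_opp : K != - K.
Proof. by rewrite -addr_eq0 -mulr2n mulrn_eq0. Qed.

Definition generic_set (c : {ffun Q -> R[i]}) : {fset U} :=
  [fset x in Q | (ext0 c x != K) && (ext0 c x != - K)]%fset.

Variable c : {ffun Q -> R[i]}.
Hypothesis c_odd : odd_on c.
Hypothesis c_relation : forall s : seq U, {subset s <= Q} ->
  (forall x, x \in s -> ext0 c x != - K) ->
  \sum_(x <- s) x \in fspan (generic_set c) ->
  forall x, x \in s -> ext0 c x != K.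

Notation O' := (generic_set c).

Lemma generic_setN x : ext0 c (- x) != - K -> ext0 c x != K.
Proof. by rewrite (ext0_odd Q_opp) // eqr_opp. Qed.

(** A quasiroot in the span is a relation with one term: if its value is not - K, [c_relation] shows
    that it is not K. If its value is - K, the same applied to [- x], of value K, is
    contradictory. *)
Lemma mem_generic x : (x \in O') = (x \in Q) && (x \in fspan O').
Proof.
rewrite in_fset_filter; have [xQ|//] := boolP (x \in Q); rewrite /=.
apply/idP/idP => [xO'|x_span].
  by apply: memv_span; rewrite /= in_fset_filter xQ.
have [cx|cx] := boolP (ext0 c x != - K); rewrite ?andbT ?andbF.
  apply: (c_relation (s := [:: x])); rewrite ?mem_head ?big_seq1 //.
    by move=> y; rewrite inE => /eqP ->.
  by move=> y; rewrite inE => /eqP ->.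
have cnx : ext0 c (- x) = K.
  by rewrite ext0_odd //; move/negPn/eqP: cx => ->; rewrite opprK.
have : ext0 c (- x) != K.
  apply: (c_relation (s := [:: - x])); rewrite ?mem_head ?big_seq1 ?rpredN //.
    by move=> y; rewrite inE => /eqP ->; rewrite Q_opp.
  by move=> y; rewrite inE => /eqP ->; rewrite cnx K_neq_opp.
by rewrite cnx eqxx.
Qed.

Variable p : 'Hom(U, U').
Hypothesis p_ker : forall x, (p x == 0) = (x \in fspan O').

Definition positive_set : {fset U'} :=
  [fset p x | x in [fset x in Q | ext0 c x == K]]%fset.

Lemma generic_value x : x \in Q -> p x != 0 -> ext0 c x = K \/ ext0 c x = - K.
Proof.
move=> xQ; rewrite p_ker => x_span.
have : x \notin O' by rewrite mem_generic xQ.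
rewrite in_fset_filter xQ /= negb_and !negbK => /orP[/eqP|/eqP]; auto.
Qed.

(** The form in which [c_relation] is used for semilinearity: each clause fails only if some
    quasiroots of value K have images with sum zero. *)
Lemma relation_false (s : seq U) x : x \in s -> {subset s <= Q} ->
  (forall y, y \in s -> ext0 c y = K) -> p (\sum_(y <- s) y) = 0 -> False.
Proof.
move=> xs sQ sK /eqP; rewrite p_ker => s_span.
have : ext0 c x != K.
  by apply: c_relation s_span _ xs => // y /sK ->; apply: K_neq_opp.
by rewrite sK ?eqxx.
Qed.

(** The point is that the value K is constant on the fibres of p: if p x = p y and y has value K,
    then p x != 0 because of the relation [[:: y]], and x cannot have value - K because of
    [[:: - x; y]]. *)
Lemma mem_positive_set x : x \in Q -> (p x \in positive_set) = (ext0 c x == K).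
Proof.
move=> xQ; apply/idP/idP => [/imfsetP[y /=]|cx]; last first.
  by apply: in_imfset; rewrite /= in_fset_filter xQ.
rewrite in_fset_filter => /andP[yQ /eqP cy] pxy.
have px0 : p x != 0.
  apply/eqP => px0; apply: (@relation_false [:: y] y).
  - exact: mem_head.
  - by move=> z; rewrite inE => /eqP ->.
  - by move=> z; rewrite inE => /eqP ->.
  by rewrite big_seq1 -pxy.
have [->//|cx] := generic_value xQ px0; exfalso.
apply: (@relation_false [:: - x; y] y).
- by rewrite !inE eqxx orbT.
- by move=> z; rewrite !inE => /orP[] /eqP ->; rewrite ?Q_opp.
- by move=> z; rewrite !inE => /orP[] /eqP -> //; rewrite ext0_odd // cx opprK.
by rewrite !big_cons big_nil addr0 linearD linearN /= pxy addNr.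
Qed.

Lemma mem_positive_setN x :
  x \in Q -> (- p x \in positive_set) = (ext0 c x == - K).
Proof.
move=> xQ; rewrite -linearN mem_positive_set ?Q_opp // ext0_odd //.
by rewrite -[in RHS]eqr_opp opprK.
Qed.

Lemma positive_setP y : y \in positive_set ->
  exists x, [/\ x \in Q, ext0 c x = K & y = p x].
Proof.
move=> /imfsetP[x /=]; rewrite in_fset_filter => /andP[xQ /eqP cx] ->.
by exists x.
Qed.

Lemma positive_neq0 x : x \in Q -> ext0 c x = K -> p x != 0.
Proof.
move=> xQ cx; apply/eqP => px0; apply: (@relation_false [:: x] x).
- exact: mem_head.
- by move=> z; rewrite inE => /eqP ->.
- by move=> z; rewrite inE => /eqP ->.
by rewrite big_seq1.
Qed.

Lemma positive_semilinear : semilinear_in Q p positive_set.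
Proof.
have in_image x : x \in Q -> p x != 0 -> p x \in image_set Q p.
  by move=> xQ px; rewrite in_fsetD1 px; apply: in_imfset.
have opp_value x : x \in Q -> ext0 c x = - K -> ext0 c (- x) = K.
  by move=> xQ cx; rewrite ext0_odd // cx opprK.
split.
- apply/fsubsetP => _ /positive_setP[x [xQ cx ->]].
  by apply: in_image => //; apply: positive_neq0.
- move=> _ _ /positive_setP[x [xQ cx ->]] /positive_setP[y [yQ cy ->]].
  rewrite in_fsetD1 => /andP[pxy0 /imfsetP[z /= zQ pz]].
  rewrite pz mem_positive_set //; have [->//|cz] : ext0 c z = K \/ ext0 c z = - K.
    by apply: generic_value => //; rewrite -pz.
  (* If z had value - K, all of x, y, - z would have value K, with images summing to zero. *)
  exfalso; apply: (@relation_false [:: x; y; - z] x).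
  + exact: mem_head.
  + by move=> u; rewrite !inE => /or3P[] /eqP ->; rewrite ?Q_opp.
  + by move=> u; rewrite !inE => /or3P[] /eqP -> //; apply: opp_value.
  by rewrite !big_cons big_nil addr0 addrA !linearD linearN /= pz subrr.
- apply/fsetP => y; rewrite in_fset0 in_fsetI; apply/negP => /andP[].
  move=> /positive_setP[x [xQ cx ->]] /imfsetP[_ /= /positive_setP[z [zQ cz ->]]].
  move=> pxz; apply: (@relation_false [:: x; z] x).
  + exact: mem_head.
  + by move=> u; rewrite !inE => /orP[] /eqP ->.
  + by move=> u; rewrite !inE => /orP[] /eqP ->.
  by rewrite !big_cons big_nil addr0 linearD /= pxz addNr.
apply/fsetP => y; rewrite in_fsetU; apply/idP/idP => [/orP[]|].
- move=> /positive_setP[x [xQ cx ->]].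
  by apply: in_image => //; apply: positive_neq0.
- move=> /imfsetP[_ /= /positive_setP[x [xQ cx ->]] ->].
  by rewrite -linearN in_image ?Q_opp // linearN oppr_eq0 positive_neq0.
rewrite in_fsetD1 => /andP[y0 /imfsetP[x /= xQ yx]]; rewrite yx in y0 *.
have [cx|cx] := generic_value xQ y0; first by rewrite mem_positive_set ?cx ?eqxx.
apply/orP; right; rewrite -[p x]opprK; apply: (in_imfset _ (fun y => - y)).
by rewrite /= mem_positive_setN ?cx.
Qed.

Lemma positive_set_unique (X : {fset U'}) : (X `<=` image_set Q p)%fset ->
  (forall x, x \in Q -> (p x \in X <-> ext0 c x = K)) -> X = positive_set.
Proof.
move=> /fsubsetP X_sub XP; apply/fsetP => y; apply/idP/idP => [yX|].
  have := X_sub _ yX; rewrite in_fsetD1 => /andP[_ /imfsetP[x /= xQ yx]].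
  by move: yX; rewrite yx mem_positive_set // => /(XP x xQ) ->.
by move=> /positive_setP[x [xQ cx ->]]; apply/XP.
Qed.

End Decomposition.

(** * Points of a stratum and regular multiplicative maps *)

Section Parametrization.
Variables (R : realType) (U U' : vectType R[i]) (Q : {fset U}) (K : R[i]).
Variables (p : 'Hom(U, U')) (O' : {fset U}) (X : {fset U'}).
Hypothesis Q_opp : forall x, (- x \in Q) = (x \in Q).
Hypothesis K_neq0 : K != 0.
Hypothesis mem_linear : forall x, (x \in O') = (x \in Q) && (p x == 0).
Hypothesis X_semilinear : semilinear_in Q p X.

Definition in_stratum_of (c : {ffun Q -> R[i]}) : Prop :=
  forall a : Q, [/\ val a \in O' <-> (c a <> K /\ c a <> - K),
                    p (val a) \in X <-> c a = K &
                    - p (val a) \in X <-> c a = - K].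

Lemma psi_neq1 (l : R[i]) : l != 1 -> psi l != 1.
Proof.
move=> l1; rewrite /psi -subr_eq0.
have -> : (l + 1) / (l - 1) - 1 = 2 / (l - 1) by field; rewrite subr_eq0.
by rewrite mulf_neq0 ?invr_eq0 ?subr_eq0 // pnatr_eq0.
Qed.

Lemma psi_neqN1 (l : R[i]) : l != 0 -> l != 1 -> psi l != -1.
Proof.
move=> l0 l1; rewrite /psi -addr_eq0.
have -> : (l + 1) / (l - 1) + 1 = l * 2 / (l - 1) by field; rewrite subr_eq0.
by rewrite !mulf_neq0 ?invr_eq0 ?subr_eq0 // pnatr_eq0.
Qed.

Lemma psi_inj (k l : R[i]) : k != 1 -> l != 1 -> psi k = psi l -> k = l.
Proof.
move=> k1 l1 kl; have : (psi k - psi l) * ((k - 1) * (l - 1)) = 2 * (l - k).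
  by rewrite /psi; field; rewrite !subr_eq0 k1 l1.
rewrite kl subrr mul0r => /esym/eqP; rewrite mulf_eq0 pnatr_eq0 /=.
by rewrite subr_eq0 => /eqP.
Qed.

(** The map psi is an involution, and (x + K) / (x - K) is psi(x / K). *)
Lemma psi_param (x : R[i]) : x != K -> psi ((x + K) / (x - K)) * K = x.
Proof.
move=> xK; have x_K : x - K != 0 by rewrite subr_eq0.
have K2 : K + K != 0 by rewrite -mulr2n mulrn_eq0.
rewrite /psi; field; rewrite x_K /=.
by rewrite [X in X != 0](_ : _ = K + K) //; ring.
Qed.

(** On [O'] the values of psi avoid 1 and - 1 because lambda avoids 1 and 0; elsewhere [X] and [- X]
    are disjoint and K != - K. *)
Lemma parametrized_in_stratum (lambda : {ffun O' -> R[i]}) c :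
  multiplicative_in lambda -> regular_in lambda ->
  corresponds_in K p X lambda c -> in_stratum_of c.
Proof.
move=> [l0 _ _] [l1 _] [cO cX cN] a; have K_nK := K_neq_opp K_neq0.
have [aO'|aO'] := boolP (val a \in O').
  have cpsi := cO a [` aO']%fset erefl; set l := lambda _ in cpsi.
  have pa : p (val a) = 0 by have := aO'; rewrite mem_linear => /andP[_ /eqP].
  have X0 : 0 \notin X.
    by apply/negP => /(semilinear_neq0 X_semilinear); rewrite eqxx.
  have cK : c a != K.
    rewrite cpsi -{2}[K]mulr1 (inj_eq (mulfI K_neq0)); exact: psi_neq1 (l1 _).
  have cnK : c a != - K.
    rewrite cpsi -mulrN1 (inj_eq (mulfI K_neq0)); exact: psi_neqN1 (l0 _) (l1 _).
  rewrite pa oppr0 (negPf X0); split; split=> //.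
  - by move=> _; split; apply/eqP.
  - by move=> caK; rewrite caK eqxx in cK.
  by move=> caK; rewrite caK eqxx in cnK.
have [aX|aX] := semilinear_total mem_linear X_semilinear (valP a) aO'.
  rewrite (cX a aX) aX (negPf (semilinear_opp X_semilinear aX)).
  split; split=> //; first by case.
  by move=> /eqP; rewrite (negPf K_nK).
have naX := semilinear_opp X_semilinear aX; rewrite opprK in naX.
rewrite (cN a aX) aX (negPf naX); split; split=> //; first by case.
by move=> /esym/eqP; rewrite (negPf K_nK).
Qed.

Lemma stratum_parameter c : Z_on K c -> in_stratum_of c ->
  exists! lambda : {ffun O' -> R[i]},
    [/\ multiplicative_in lambda, regular_in lambda &
        corresponds_in K p X lambda c].
Proof.
move=> [c_odd c_rel] c_str.
have O'Q x : x \in O' -> x \in Q by rewrite mem_linear => /andP[].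
have O'val (a' : O') : [/\ ext0 c (val a') != K & ext0 c (val a') != - K].
  have aQ := O'Q _ (valP a'); have [[+ _] _ _] := c_str [` aQ]%fset.
  by move=> /(_ (valP a'))[cK cnK]; rewrite (ext0_in _ aQ); split; apply/eqP.
pose l (x : R[i]) := (x + K) / (x - K).
pose lambda : {ffun O' -> R[i]} := [ffun a' => l (ext0 c (val a'))].
have K2 : K + K != 0 by rewrite -mulr2n mulrn_eq0.
have l_neq1 a' : lambda a' != 1.
  have [cK _] := O'val a'; rewrite ffunE /l -subr_eq0.
  have -> : (ext0 c (val a') + K) / (ext0 c (val a') - K) - 1 =
            (K + K) / (ext0 c (val a') - K) by field; rewrite subr_eq0.
  by rewrite mulf_neq0 ?invr_eq0 ?subr_eq0.
have lM (a b s : O') : val s = val a + val b -> lambda s = lambda a * lambda b.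
  move=> sab; have [aK _] := O'val a; have [bK _] := O'val b.
  have [sK _] := O'val s; rewrite !ffunE /l.
  have nsQ : - val s \in Q by rewrite Q_opp O'Q ?(valP s).
  have abs0 : val a + val b - val s = 0 by rewrite sab subrr.
  have := c_rel _ _ _ (O'Q _ (valP a)) (O'Q _ (valP b)) nsQ abs0.
  rewrite /Z_relation ext0_odd //.
  move: (ext0 c (val a)) (ext0 c (val b)) (ext0 c (val s)) aK bK sK.
  move=> u v w uK vK wK uvw.
  apply/eqP; rewrite -subr_eq0; apply/eqP.
  (* The numerator is 2 K times the left-hand side of the relation for a, b, - s, whose third value
     is - w. *)
  have -> : (w + K) / (w - K) - (u + K) / (u - K) * ((v + K) / (v - K)) =
    2 * K * (u * v + v * - w + - w * u + K ^+ 2) /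
      ((w - K) * (u - K) * (v - K)).
    by field; rewrite !subr_eq0 uK vK wK.
  by rewrite uvw mulr0 mul0r.
exists lambda; split=> [|lambda' [[_ _ _] [l1' _] [cO' _ _]]]; last first.
  apply/ffunP => a'; apply: psi_inj => //.
  have aQ := O'Q _ (valP a'); have := cO' [` aQ]%fset a' erefl.
  rewrite -ext0_in ffunE => cpsi; apply: (mulfI K_neq0).
  by rewrite -cpsi mulrC psi_param //; case: (O'val a').
split.
- split=> // [a'|a b ab].
    have [cK cnK] := O'val a'.
    by rewrite ffunE mulf_neq0 ?invr_eq0 ?subr_eq0 // addr_eq0.
  have [aK naK] := O'val a; rewrite !ffunE ab ext0_odd // /l.
  rewrite invf_div -[RHS]divrNN !opprD !opprK.
  by congr (_ / _); rewrite addrC.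
(* The product of the two values is [lambda s], which is never 1, so regularity holds vacuously. *)
- split=> // a b s sab ab1; have := l_neq1 s.
  by rewrite (lM a b s) // ab1 eqxx.
split=> a.
- move=> a' aa'; rewrite ffunE aa' ext0E mulrC psi_param //.
  by have [] := O'val a'; rewrite aa' ext0E.
- by move=> aX; have [_ [+ _] _] := c_str a; apply.
by move=> aX; have [_ _ [+ _]] := c_str a; apply.
Qed.

End Parametrization.

(** * From relations between roots to relations between quasiroots *)

Section QuasirootRelations.
Variables (R : realType) (V U : vectType R[i]) (Omega Pi Gamma : {fset V}).
Variables (q : 'Hom(V, U)) (Q : {fset U}).
Hypothesis Omega_opp : forall a, a \in Omega -> - a \in Omega.
Hypothesis Omega_sum : forall a (s : seq V), a \in Omega ->
  {subset s <= Omega} -> a + \sum_(b <- s) b = 0 ->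
  exists2 b, b \in s & (a + b == 0) || (a + b \in Omega).
Hypothesis Pi_free : free (enum_fset Pi).
Hypothesis Pi_sub : {subset Pi <= Omega}.
Hypothesis Omega_int :
  forall a, a \in Omega -> integral_comb (enum_fset Pi) a.
Hypothesis Gamma_sub : {subset Gamma <= Pi}.
Hypothesis q_ker : forall v, (q v == 0) = (v \in fspan Gamma).
Hypothesis mem_Q :
  forall x, x \in Q <-> x != 0 /\ exists2 a, a \in Omega & x = q a.

(** By freeness of [Pi] the coordinates outside [Gamma] vanish; the others are integral multiples of
    roots in [Gamma]. *)
Lemma integral_span_sum v : integral_comb (enum_fset Pi) v ->
  v \in fspan Gamma ->
  sum_in [pred a | (a \in Omega) && (a \in fspan Gamma)] v.
Proof.
move=> [z v_int] vGamma.
have z0 y : y \in Pi -> y \notin Gamma -> (z y)%:~R = 0 :> R[i].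
  apply: (@free_sub_coef _ _ _ _ (fun y => (z y)%:~R) Pi_free (fset_uniq Gamma)).
    exact: Gamma_sub.
  under eq_bigr do rewrite scaler_int.
  by rewrite -v_int.
have -> : v = \sum_(y <- enum_fset Pi | y \in Gamma) y *~ z y.
  rewrite v_int [RHS]big_mkcond; apply: eq_big_seq => y yPi.
  case: ifP => // /negbT /(z0 y yPi) /eqP; rewrite intr_eq0 => /eqP ->.
  exact: mulr0z.
apply: sum_in_int => [a|y yG].
  by rewrite !inE => /andP[aO aG]; rewrite Omega_opp // rpredN.
by rewrite inE Pi_sub ?Gamma_sub // memv_span.
Qed.

(* Every relation x + y + z = 0 between quasiroots comes from a relation between
   roots: lift x, y, z arbitrarily, write the sum of the lifts as a sum of roots
   in the span of Gamma, and absorb these one at a time. *)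
Lemma lift_relation x y z : x \in Q -> y \in Q -> z \in Q -> x + y + z = 0 ->
  exists a b c, [/\ a \in Omega, b \in Omega & c \in Omega] /\
    [/\ q a = x, q b = y, q c = z & a + b + c = 0].
Proof.
move=> /mem_Q[x0 [a aO xa]] /mem_Q[y0 [b bO yb]] /mem_Q[z0 [c cO zc]] xyz.
have abc : a + b + c \in fspan Gamma.
  by rewrite -q_ker !linearD /= -xa -yb -zc xyz.
have nabc : - (a + b + c) \in fspan Gamma by rewrite rpredN.
have nabc_int : integral_comb (enum_fset Pi) (- (a + b + c)).
  rewrite 2!opprD; do 2 ?apply: integral_combD; apply: Omega_int;
  exact: Omega_opp.
have [s sOG sum_s] := integral_span_sum nabc_int nabc.
have [||||||a' [b' [c' [abcO [a'a b'b c'c abc0]]]]] := lift_triple Omega_sum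
  (W := fspan Gamma) (s := s) _ _ aO bO cO.
- by move=> d /sOG; rewrite inE => /andP[].
- by move=> d /sOG; rewrite inE => /andP[].
- by rewrite -q_ker -xa.
- by rewrite -q_ker -yb.
- by rewrite -q_ker -zc.
- by rewrite -sum_s subrr.
exists a', b', c'; split=> //; rewrite xa yb zc.
by split=> //; apply/eqP; rewrite -subr_eq0 -linearB q_ker.
Qed.

Variables (K : R[i]) (c : {ffun Q -> R[i]}).
Hypothesis K_neq0 : K != 0.
Hypothesis c_Z : Z_on K c.

Lemma Q_opp x : (- x \in Q) = (x \in Q).
Proof.
suff opp y : y \in Q -> - y \in Q by apply/idP/idP => /opp; rewrite ?opprK.
move=> /mem_Q[y0 [a aO ya]]; apply/mem_Q; rewrite oppr_eq0.
by split=> //; exists (- a); rewrite ?linearN ?ya //; apply: Omega_opp.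
Qed.

Lemma mem_Q_image a : a \in Omega -> q a != 0 -> q a \in Q.
Proof. by move=> aO qa; apply/mem_Q; split=> //; exists a. Qed.

(* The roots with c != -K form a parabolic subset. *)
Lemma value_closed a b : a \in Omega -> b \in Omega ->
  ext0 c (q a) != - K -> ext0 c (q b) != - K -> a + b \in Omega ->
  ext0 c (q (a + b)) != - K.
Proof.
have [c_odd c_rel] := c_Z => aO bO ca cb abO.
have [qa|qa] := eqVneq (q a) 0; first by rewrite linearD /= qa add0r.
have [qb|qb] := eqVneq (q b) 0; first by rewrite linearD /= qb addr0.
(* On roots in the span of [Gamma] the extended value is 0, which is not - K as K != 0. *)
have [qab|qab] := eqVneq (q (a + b)) 0.
  rewrite qab ext0_out; first by rewrite eq_sym oppr_eq0.
  by apply/negP => /mem_Q[]; rewrite eqxx.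
have nabQ : - q (a + b) \in Q by rewrite Q_opp mem_Q_image.
have sum0 : q a + q b - q (a + b) = 0 by rewrite linearD subrr.
have := c_rel _ _ _ (mem_Q_image aO qa) (mem_Q_image bO qb) nabQ sum0.
rewrite /Z_relation (ext0_odd Q_opp) //; apply: contra_eq_neq => ->.
(* With the value - K at a + b the relation factors into two nonzero terms. *)
have -> : ext0 c (q a) * ext0 c (q b) + ext0 c (q b) * - - K +
    - - K * ext0 c (q a) + K ^+ 2 = (ext0 c (q a) + K) * (ext0 c (q b) + K).
  by ring.
by rewrite mulf_neq0 // addr_eq0.
Qed.

(** This is [parabolic_relation] for chosen lifts of the terms of [s], with T the roots of value
    other than - K. The hypothesis on the span lifts because the kernel of [q] is contained in the
    span [L] upstairs. *)
Lemma quasiroot_relation (s : seq U) : {subset s <= Q} ->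
  (forall x, x \in s -> ext0 c x != - K) ->
  \sum_(x <- s) x \in fspan (generic_set K c) ->
  forall x, x \in s -> ext0 c x != K.
Proof.
have [c_odd c_rel] := c_Z => sQ s_val s_span.
have /choice[r rP] (x : U) : exists a, x \in Q -> a \in Omega /\ q a = x.
  have [/mem_Q[_ [a aO xa]]|_] := boolP (x \in Q); first by exists a.
  by exists 0.
have rQ x : x \in s -> r x \in Omega /\ q (r x) = x by move=> /sQ /rP.
pose T := [pred a | ext0 c (q a) != - K].
have T_neg x : x \in s -> - r x \in T -> ext0 c x != K.
  move=> /rQ[_ qr]; rewrite inE linearN /= qr; exact: generic_setN Q_opp _ _ _.
move=> x xs; apply: (T_neg x xs).
apply: (parabolic_relation Omega_opp Omega_sum Pi_free Omega_int
  (s := [seq r y | y <- s])).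
- exact: value_closed.
- by move=> _ /mapP[y /rQ[? _] ->].
- by move=> _ /mapP[y ys ->]; have [_ qr] := rQ _ ys; rewrite inE qr s_val.
- set L := <<_>>%VS; rewrite big_map.
  have memL a : a \in Omega -> ext0 c (q a) != K -> ext0 c (q a) != - K -> a \in L.
    move=> aO aK anK; apply: memv_span; rewrite mem_filter !inE aO andbT anK /=.
    by rewrite linearN /= (ext0_odd Q_opp) // eqr_opp.
  (* Elements of [Gamma] have extended value 0, different from K and - K, so they belong to the
     family spanning [L]. *)
  have GammaL : (fspan Gamma <= L)%VS.
    apply/span_subvP => y yG; have qy : q y = 0.
      by apply/eqP; rewrite q_ker memv_span.
    have c0 : ext0 c (q y) = 0.
      by rewrite ext0_out // qy; apply/negP => /mem_Q[]; rewrite eqxx.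
    by apply: memL; rewrite ?c0 1?eq_sym ?oppr_eq0 //; apply/Pi_sub/Gamma_sub.
  have : q (\sum_(y <- s) r y) \in (q @: L)%VS.
    rewrite linear_sum /= (eq_big_seq (fun y => y)) => [|y /rQ[]//].
    apply: subvP s_span; apply/span_subvP => y.
    rewrite in_fset_filter => /and3P[yQ yK ynK].
    have [rO qr] := rP _ yQ; rewrite -qr in yK ynK *.
    by apply: memv_img; apply: memL.
  move=> /memv_imgP[u uL quE].
  rewrite -[X in X \in L](subrK u) rpredD //; apply: (subvP GammaL).
  by rewrite -q_ker linearB /= quE subrr.
exact: map_f.
Qed.

End QuasirootRelations.

(** * The Schouten bracket *)

Lemma nth3_ind (T : Type) (P : T -> Prop) a b c (i : 'I_3) :
  P a -> P b -> P c -> P (nth a [:: a; b; c] i).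
Proof. by case: i => -[|[|[|]]]. Qed.

(** * Sums over triples *)

Section TripleSums.
Variables (F : comPzRingType) (I : eqType) (s : seq I).
Implicit Types f : I -> I -> I -> F.

Definition triple_sum f := \sum_(a <- s) \sum_(b <- s) \sum_(c <- s) f a b c.

Lemma triple_sum_rot f : triple_sum (fun a b c => f b c a) = triple_sum f.
Proof.
rewrite /triple_sum exchange_big; apply: eq_bigr => b _.
by rewrite exchange_big.
Qed.

Lemma eq_triple_sum f f' :
  {in s & &, forall a b c, f a b c = f' a b c} -> triple_sum f = triple_sum f'.
Proof.
move=> ff'; rewrite /triple_sum !big_seq; apply: eq_bigr => a aS.
rewrite !big_seq; apply: eq_bigr => b bS.
by rewrite !big_seq; apply: eq_bigr => c cS; apply: ff'.
Qed.

Lemma triple_sumD f f' : triple_sum f + triple_sum f' =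
  triple_sum (fun a b c => f a b c + f' a b c).
Proof.
rewrite /triple_sum -big_split; apply: eq_bigr => a _.
by rewrite -big_split; apply: eq_bigr => b _; rewrite -big_split.
Qed.

Lemma triple_sumZ k f :
  k * triple_sum f = triple_sum (fun a b c => k * f a b c).
Proof.
rewrite /triple_sum mulr_sumr; apply: eq_bigr => a _.
by rewrite mulr_sumr; apply: eq_bigr => b _; rewrite mulr_sumr.
Qed.

Hypothesis s_uniq : uniq s.

Lemma sum_delta (f : I -> F) x : x \in s -> \sum_(a <- s) f a * (a == x)%:R = f x.
Proof.
move=> xs; rewrite (bigD1_seq x) //= eqxx mulr1 big1 ?addr0 // => a ax.
by rewrite (negPf ax) mulr0.
Qed.

Lemma triple_sum_delta f x y z : x \in s -> y \in s -> z \in s ->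
  triple_sum (fun a b c => f a b c * ((a == x)%:R * (b == y)%:R * (c == z)%:R)) =
  f x y z.
Proof.
move=> xs ys zs; rewrite -[RHS](sum_delta (fun a => f a y z) xs).
apply: eq_bigr => a _; rewrite -(sum_delta (fun b => f a b z) ys) mulr_suml.
apply: eq_bigr => b _; rewrite -(sum_delta (fun c => f a b c) zs) !mulr_suml.
by apply: eq_bigr => c _; ring.
Qed.

End TripleSums.

(** * Decomposable three-vectors as determinants *)

Section Determinants.
Variable F : comNzRingType.

Lemma det_mx33 (M : 'M[F]_3) (m := fun k l : nat => M (inord k) (inord l)) :
  \det M = m 0 0 * (m 1 1 * m 2 2 - m 1 2 * m 2 1)
    - m 0 1 * (m 1 0 * m 2 2 - m 1 2 * m 2 0)
    + m 0 2 * (m 1 0 * m 2 1 - m 1 1 * m 2 0).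
Proof.
have det_mx22 (N : 'M[F]_2) :
    \det N = N 0 0 * N ord_max ord_max - N 0 ord_max * N ord_max 0.
  rewrite (expand_det_row N 0) !big_ord_recl big_ord0 addr0 /cofactor.
  rewrite !det_mx11 !mxE /= expr0 expr1 mul1r mulN1r mulrN.
  by congr (_ * N _ _ - N _ _ * N _ _); apply: val_inj.
have mE i j : M i j = m i j by rewrite /m !inord_val.
rewrite (expand_det_row M 0) !big_ord_recl big_ord0 addr0 /cofactor.
rewrite !det_mx22 !mxE /= !mE /= /bump /=; ring.
Qed.
End Determinants.

Section Wedge.
Variables (R : realType) (g : vectType R[i]) (xi : 'I_3 -> 'Hom(g, R[i]^o)).

Let e (k : nat) (x : g) : R[i] := xi (inord k) x.

Lemma wedge3E x y z : wedge3 x y z xi =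
  e 0 x * (e 1 y * e 2 z - e 1 z * e 2 y)
    - e 0 y * (e 1 x * e 2 z - e 1 z * e 2 x)
    + e 0 z * (e 1 x * e 2 y - e 1 y * e 2 x).
Proof.
rewrite /wedge3 det_mx33 !mxE !(tnth_nth 0) !inordK //=.
Qed.

Lemma wedge3_rot x y z : wedge3 y z x xi = wedge3 x y z xi.
Proof. by rewrite !wedge3E; ring. Qed.

Lemma wedge3Z a x y z : wedge3 (a *: x) y z xi = a * wedge3 x y z xi.
Proof.
have eZ k : e k (a *: x) = a * e k x by rewrite /e linearZ.
by rewrite !wedge3E !eZ; ring.
Qed.

Lemma wedge3_eq0 x y z : (forall i, xi i x = 0) -> wedge3 x y z xi = 0.
Proof.
move=> x0; have ex k : e k x = 0 by apply: x0.
by rewrite wedge3E !ex; ring.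
Qed.

End Wedge.

(** * The Schouten bracket as a sum over triples of roots *)

Section Schouten.
Variables (R : realType) (g : vectType R[i]) (ad : 'Hom(g, 'End(g))).
Variables (V : zmodType) (Om P : seq V) (E : V -> g).
Variable xi : 'I_3 -> 'Hom(g, R[i]^o).
Hypothesis Om_uniq : uniq Om.
Hypothesis Om_opp : forall a, a \in Om -> - a \in Om.
Hypothesis Om_split : perm_eq Om (P ++ [seq - a | a <- P]).
Hypothesis xi_opp : forall a i, a \in Om -> xi i (ad (E a) (E (- a))) = 0.
Hypothesis ad_notin : forall a b, a \in Om -> b \in Om ->
  a + b != 0 -> a + b \notin Om -> ad (E a) (E b) = 0.
Variable N : V -> V -> V -> R[i].
Hypothesis adN : forall a b c, a + b + c = 0 -> a \in Om -> b \in Om ->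
  c \in Om -> ad (E a) (E b) = N a b c *: E (- c).
Hypothesis N_rot : forall a b c, N b c a = N a b c.

Notation W x y z := (wedge3 x y z xi).

Definition triple_term (a b c : V) : R[i] :=
  if a + b + c == 0 then N a b c * W (E (- a)) (E (- b)) (E (- c)) else 0.

Lemma triple_term_rot a b c : triple_term b c a = triple_term a b c.
Proof.
rewrite /triple_term N_rot wedge3_rot.
by have -> : b + c + a = a + b + c by rewrite addrC addrA.
Qed.

(** At most c = - (a + b) contributes. If it is not a root, either the bracket vanishes or a + b =
    0, and then the bracket is killed by [xi]. *)
Lemma wedge3_bracket a b : a \in Om -> b \in Om ->
  W (ad (E a) (E b)) (E (- a)) (E (- b)) = \sum_(c <- Om) triple_term a b c.
Proof.
move=> aO bO; have [abO|abO] := boolP (- (a + b) \in Om).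
  rewrite (bigD1_seq (- (a + b))) //= /triple_term subrr eqxx.
  rewrite (@adN a b (- (a + b))) ?subrr // wedge3Z 2!wedge3_rot.
  rewrite big1 ?addr0 // => c cab.
  by rewrite addrC addr_eq0 (negPf cab).
rewrite big1_seq /triple_term => [|c /= cO]; last first.
  by case: eqP => // /eqP; rewrite addrC addr_eq0 => /eqP cE; rewrite -cE cO in abO.
have [/eqP|ab0] := eqVneq (a + b) 0; last first.
  rewrite ad_notin //; last by apply: contra abO; apply: Om_opp.
  by apply: wedge3_eq0 => i; rewrite linear0.
rewrite addrC addr_eq0 => /eqP ->; apply: wedge3_eq0 => i; exact: xi_opp.
Qed.

Variable C : V -> R[i].

(** Brings f, which involves only roots outside the span of [Gamma], to the same shape as r. *)
Lemma schouten_support (D : pred V) : (forall a, ~~ D a -> C a = 0) ->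
  let f := [seq (C a, (E a, E (- a))) | a <- P] in
  let f' := [seq (C a, (E a, E (- a))) | a <- P & D a] in
  schouten ad f' f' xi = schouten ad f f xi.
Proof.
move=> CD f f'; rewrite /schouten /f /f' !big_map !big_filter big_mkcond.
apply: eq_bigr => a _; rewrite !big_map big_filter /=.
case: ifP => [_|/negbT/CD Ca]; last by rewrite big1 // => b _; rewrite Ca !mul0r.
rewrite big_mkcond; apply: eq_bigr => b _.
by case: ifP => // /negbT/CD ->; rewrite mulr0 mul0r.
Qed.

Hypothesis C_odd : forall a, a \in Om -> C (- a) = - C a.

(** The four terms of the Schouten bracket for positive a, b are the four choices of signs in (a, b)
    up to opposite; oddness of [C] accounts for their signs. *)
Lemma schouten_triple_sum (f : bivector g) :
  f = [seq (C a, (E a, E (- a))) | a <- P] ->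
  schouten ad f f xi = triple_sum Om (fun a b c => C a * C b * triple_term a b c).
Proof.
move=> ->; have PO a : a \in P -> a \in Om.
  by move=> aP; rewrite (perm_mem Om_split) mem_cat aP.
have split_sum (phi : V -> R[i]) :
    \sum_(a <- Om) phi a = \sum_(a <- P) (phi a + phi (- a)).
  by rewrite (perm_big _ Om_split) big_cat big_map big_split.
pose G a b := C a * C b * W (ad (E a) (E b)) (E (- a)) (E (- b)).
transitivity (\sum_(a <- Om) \sum_(b <- Om) G a b); last first.
  apply: eq_big_seq => a aO; apply: eq_big_seq => b bO.
  by rewrite /G wedge3_bracket // mulr_sumr.
rewrite split_sum /schouten big_map; apply: eq_big_seq => a /PO aO.
rewrite !split_sum big_map -big_split; apply: eq_big_seq => b /PO bO /=.
by rewrite /G !C_odd // !opprK; ring.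
Qed.

(** The factor 3 comes from adding the three rotations of the sum, under which [triple_term] is
    invariant. *)
Lemma schouten_symmetrized (f : bivector g) :
  f = [seq (C a, (E a, E (- a))) | a <- P] ->
  3 * schouten ad f f xi = triple_sum Om (fun a b c =>
    (C a * C b + C b * C c + C c * C a) * triple_term a b c).
Proof.
move=> /schouten_triple_sum ->; set S := triple_sum _ _.
have S1 : S = triple_sum Om (fun a b c => C b * C c * triple_term a b c).
  rewrite /S -triple_sum_rot; apply: eq_triple_sum => a b c _ _ _.
  by rewrite triple_term_rot.
have S2 : S = triple_sum Om (fun a b c => C c * C a * triple_term a b c).
  rewrite S1 -triple_sum_rot; apply: eq_triple_sum => a b c _ _ _.
  by rewrite triple_term_rot.
have -> : 3 * S = S + S + S by ring.
rewrite {2}S1 {2}S2 /S !triple_sumD; apply: eq_triple_sum => a b c _ _ _.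
by ring.
Qed.

End Schouten.

Section DualTriple.
Variables (R : realType) (g : vectType R[i]) (V : zmodType) (Om : seq V).
Variables (E : V -> g) (xi : 'I_3 -> 'Hom(g, R[i]^o)) (a0 a1 a2 : V).
Variables (N coef : V -> V -> V -> R[i]).
Hypothesis Om_uniq : uniq Om.
Hypothesis a0O : a0 \in Om.
Hypothesis a1O : a1 \in Om.
Hypothesis a2O : a2 \in Om.
Hypothesis a_sum : a0 + a1 + a2 = 0.
Hypothesis xi_dual : forall i a, a \in Om ->
  xi i (E (- a)) = (a == nth a0 [:: a0; a1; a2] i)%:R.
Hypothesis N_rot : forall a b c, N b c a = N a b c.
Hypothesis N_swap : forall a b c, a + b + c = 0 -> N b a c = - N a b c.
Hypothesis coef_rot : forall a b c, coef b c a = coef a b c.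
Hypothesis coef_swap : forall a b c, coef b a c = coef a b c.

(* On the dual basis the six permutations of (a0, a1, a2) contribute equally. *)
Lemma triple_sum_extract :
  triple_sum Om (fun a b c => coef a b c * triple_term E xi N a b c) =
  6 * (coef a0 a1 a2 * N a0 a1 a2).
Proof.
(* [A] is alternating, which compensates for the signs in the expansion of the determinant. *)
pose A a b c := coef a b c * (if a + b + c == 0 then N a b c else 0).
have A_rot a b c : A b c a = A a b c.
  rewrite /A N_rot coef_rot.
  by have -> : b + c + a = a + b + c by rewrite addrC addrA.
have A_swap a b c : A b a c = - A a b c.
  rewrite /A coef_swap [b + a]addrC; case: eqP => abc; rewrite ?mulr0 ?oppr0 //.
  by rewrite N_swap // mulrN.
pose D (x y z a b c : V) : R[i] := (a == x)%:R * (b == y)%:R * (c == z)%:R.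
have WE : {in Om & &, forall a b c, coef a b c * triple_term E xi N a b c =
    A a b c * D a0 a1 a2 a b c + (- A a b c) * D a0 a2 a1 a b c
    + ((- A a b c) * D a1 a0 a2 a b c + A a b c * D a1 a2 a0 a b c)
    + (A a b c * D a2 a0 a1 a b c + (- A a b c) * D a2 a1 a0 a b c)}.
  move=> a b c aO bO cO; rewrite /triple_term /A.
  case: ifP => _; last by rewrite !mulr0 oppr0; ring.
  by rewrite wedge3E !xi_dual // !inordK //= /D; ring.
rewrite (eq_triple_sum WE) -!triple_sumD !triple_sum_delta //.
have A012 : A a0 a1 a2 = coef a0 a1 a2 * N a0 a1 a2.
  by rewrite /A a_sum eqxx.
have e1 : A a0 a2 a1 = - A a0 a1 a2 by rewrite A_swap -A_rot.
have e2 : A a1 a0 a2 = - A a0 a1 a2 by rewrite A_swap.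
have e3 : A a2 a1 a0 = - A a0 a1 a2 by rewrite A_swap A_rot.
rewrite e1 e2 e3 -A012 (A_rot a0 a1 a2) (_ : A a2 a0 a1 = A a0 a1 a2).
  by ring.
by rewrite -A_rot.
Qed.

End DualTriple.

(** * Existence and uniqueness of strata and of their points *)

Section StrataOfQuasiroots.
Variables (R : realType) (U : vectType R[i]) (Q : {fset U}) (K : R[i]).
Hypothesis Q_opp : forall x, (- x \in Q) = (x \in Q).

Definition linear_in (O' : {fset U}) : Prop :=
  O' = [fset x in Q | x \in fspan O']%fset.

Lemma mem_linear_in O' x : linear_in O' ->
  (x \in O') = (x \in Q) && (qproj (fspan O') x == 0).
Proof.
move=> O'_linear; rewrite mem_lker_qproj.
rewrite -(in_fset_filter Q (fun y => y \in fspan O')).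
exact: (congr1 (fun A : {fset _} => x \in A) O'_linear).
Qed.

Lemma linear_in_sub O' x : linear_in O' -> x \in O' -> x \in Q.
Proof. by move=> /mem_linear_in -> /andP[]. Qed.

Lemma stratum_point O' (X : {fset quot (fspan O')}) (lambda : {ffun O' -> R[i]}) :
  linear_in O' -> semilinear_in Q (qproj (fspan O')) X ->
  multiplicative_in lambda -> regular_in lambda ->
  exists! c : {ffun Q -> R[i]},
    Z_on K c /\ corresponds_in K (qproj (fspan O')) X lambda c.
Proof.
move=> O'_linear X_semi lM lreg.
have memO' x := mem_linear_in x O'_linear.
have [c cP] := corr_exists K memO' X_semi lambda.
exists c; split; first by split=> //; apply: corr_Z cP.
by move=> c' [_ c'P]; apply: corr_unique cP c'P.
Qed.

Hypothesis K_neq0 : K != 0.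

Lemma stratum_decomposition (c : {ffun Q -> R[i]}) : Z_on K c ->
  (forall s : seq U, {subset s <= Q} ->
    (forall x, x \in s -> ext0 c x != - K) ->
    \sum_(x <- s) x \in fspan (generic_set K c) ->
    forall x, x \in s -> ext0 c x != K) ->
  exists! O' : {fset U}, linear_in O' /\
    exists! X : {fset quot (fspan O')},
      semilinear_in Q (qproj (fspan O')) X /\
      in_stratum_of K (qproj (fspan O')) O' X c.
Proof.
move=> [c_odd _] c_rel; pose O' := generic_set K c.
pose p := qproj (fspan O'); have p_ker x := mem_lker_qproj (fspan O') x.
have O'_linear : linear_in O'.
  apply/fsetP => x; rewrite [RHS]in_fset_filter.
  by have := mem_generic Q_opp K_neq0 c_odd c_rel; apply.
have O'P (a : Q) : val a \in O' <-> c a <> K /\ c a <> - K.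
  rewrite in_fset_filter (valP a) /= ext0E.
  by split=> [/andP[/eqP ? /eqP]|[/eqP -> /eqP]].
exists O'; split; last first.
  (* The values of [c] decide which quasiroots belong to [O''], and linearity excludes all other
     elements. *)
  move=> O'' [O''_linear [X [[_ X_str] _]]]; apply/fsetP => x.
  have iff (xQ : x \in Q) : x \in O' <-> x \in O''.
    have [xO'' _ _] := X_str [` xQ]%fset; have xO' := O'P [` xQ]%fset.
    by rewrite (iff_trans xO' (iff_sym xO'')).
  apply/idP/idP => [xO'|xO''].
    by apply/iff => //; apply: linear_in_sub xO'.
  by apply/iff => //; apply: linear_in_sub xO''.
split=> //; exists (positive_set K c p); split; last first.
  move=> X [[X_sub _ _ _] X_str]; symmetry.
  apply: (positive_set_unique Q_opp K_neq0 c_odd c_rel p_ker X_sub) => x xQ.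
  by have [_ ? _] := X_str [` xQ]%fset; rewrite (ext0_in _ xQ).
split; first exact: (positive_semilinear Q_opp K_neq0 c_odd c_rel p_ker).
move=> a; have aQ := valP a; split; first exact: O'P.
  rewrite (mem_positive_set Q_opp K_neq0 c_odd c_rel p_ker) // ext0E.
  by split=> /eqP.
rewrite (mem_positive_setN Q_opp K_neq0 c_odd c_rel p_ker) // ext0E.
by split=> /eqP.
Qed.

End StrataOfQuasiroots.

(** * The Levi subalgebra, signs of roots and the variety *)

Section Assembly.
Variables (R : realType) (g : vectType R[i]) (ad : 'Hom(g, 'End(g))).
Variables (h : {vspace g}) (Omega Pi Gamma : {fset dual h}) (E : dual h -> g).
Variable K : R[i].
Hypothesis g_simple : simple_lie ad.
Hypothesis h_cartan : cartan_subalgebra ad h.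
Hypothesis Omega_roots : forall alpha, alpha \in Omega <-> is_root ad alpha.
Hypothesis Pi_simple : simple_roots Omega Pi.
Hypothesis Gamma_sub : (Gamma `<=` Pi)%fset.
Hypothesis E_vectors : normalized_root_vectors ad Omega E.

Let Omega_opp := root_opp g_simple h_cartan Omega_roots E_vectors.
Let Omega_sum := root_sum_eq0 g_simple h_cartan Omega_roots E_vectors.

Let Pi_free : free (enum_fset Pi). Proof. by case: Pi_simple. Qed.

Let Pi_sub : {subset Pi <= Omega}.
Proof. by case: Pi_simple => /fsubsetP. Qed.

Let Gamma_Pi : {subset Gamma <= Pi}. Proof. exact/fsubsetP. Qed.

Lemma nat_comb_integral a : nat_comb Pi a -> integral_comb (enum_fset Pi) a.
Proof. by move=> [n ->]; exists (fun y => n y). Qed.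

Let Omega_int a : a \in Omega -> integral_comb (enum_fset Pi) a.
Proof.
case: Pi_simple => _ _ sgn /sgn[/nat_comb_integral //|/nat_comb_integral[z az]].
exists (fun y => - z y); rewrite -[LHS]opprK az -sumrN.
by apply: eq_bigr => y _; rewrite mulrNz.
Qed.

Lemma nat_combD a b : nat_comb Pi a -> nat_comb Pi b -> nat_comb Pi (a + b).
Proof.
move=> [n ->] [m ->]; exists (fun y => (n y + m y)%N).
by rewrite -big_split; apply: eq_bigr => y _; rewrite mulrnDr.
Qed.

Lemma positive_opp a : a \in Omega -> nat_comb Pi a -> ~ nat_comb Pi (- a).
Proof.
move=> aO [n an] [m am]; have /eqP[] := root_neq0 Omega_roots aO.
have nm0 : \sum_(y <- enum_fset Pi) (n y + m y)%:R *: y = 0.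
  rewrite -[RHS](subrr a) {1}an am -big_split; apply: eq_bigr => y _.
  by rewrite scaler_nat mulrnDr.
rewrite an big1_seq // => y /= yPi; have /eqP := free_seqP Pi_free nm0 yPi.
by rewrite pnatr_eq0 addn_eq0 => /andP[/eqP -> _].
Qed.

(** The relation a - sum = 0 provides a term b with a - b zero or a root; in the second case [E a]
    is a nonzero multiple of the bracket of [E b] and [E (a - b)], and a - b is a shorter sum. *)
Lemma root_in_subalgebra (U : {vspace g}) (s : seq (dual h)) :
  lie_subalgebra ad U -> {subset s <= Omega} ->
  (forall b, b \in s -> E b \in U) ->
  \sum_(b <- s) b \in Omega -> E (\sum_(b <- s) b) \in U.
Proof.
move=> U_sub; have [n] := ubnP (size s); elim: n s => // n IHn s.
rewrite ltnS => s_n sO sU aO; set a := \sum_(b <- s) b in aO *.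
have [||_ /mapP[b bs ->]] := Omega_sum aO (s := [seq - b | b <- s]).
- by move=> _ /mapP[b /sO /Omega_opp bO ->].
- by rewrite big_map sumrN subrr.
have aE : a = b + \sum_(d <- rem b s) d.
  by rewrite /a (perm_big _ (perm_to_rem bs)) big_cons.
rewrite subr_eq0 => /orP[/eqP ->|]; first exact: sU.
have -> : a - b = \sum_(d <- rem b s) d by rewrite aE addrC addKr.
move=> a'O; set a' := \sum_(d <- rem b s) d in aE a'O.
have a'U : E a' \in U.
  apply: IHn => // [|y /mem_rem /sO //|y /mem_rem /sU //].
  by rewrite size_rem // (leq_trans _ s_n) // ltn_predL; case: (s) bs.
have naO := Omega_opp aO; have bO := sO _ bs.
have sum0 : b + a' + - a = 0 by rewrite -aE subrr.
have := U_sub _ _ (sU _ bs) a'U.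
rewrite (ad_rootE g_simple h_cartan Omega_roots E_vectors sum0) // opprK.
rewrite rpredZeq => /orP[|//]; apply: contraTT => _.
exact: (structure_constant_neq0 g_simple h_cartan Omega_roots E_vectors sum0).
Qed.

Lemma nat_comb_span a : nat_comb Pi a -> a \in fspan Gamma ->
  exists2 s : seq (dual h), {subset s <= Gamma} & a = \sum_(b <- s) b.
Proof.
move=> [n an] aG.
have n0 y : y \in Pi -> y \notin Gamma -> (n y)%:R = 0 :> R[i].
  apply: (@free_sub_coef _ _ _ _ (fun y => (n y)%:R) Pi_free (fset_uniq Gamma)).
    exact: Gamma_Pi.
  by under eq_bigr do rewrite scaler_nat; rewrite -an.
have -> : a = \sum_(y <- enum_fset Pi | y \in Gamma) y *+ n y.
  rewrite an [RHS]big_mkcond; apply: eq_big_seq => y yPi.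
  by case: ifP => // /negbT /(n0 y yPi) /eqP; rewrite pnatr_eq0 => /eqP ->.
pose S v := exists2 s : seq (dual h), {subset s <= Gamma} & v = \sum_(b <- s) b.
apply: (big_ind S) => [|_ _ [s sG ->] [t tG ->]|y yG].
- by exists [::]; rewrite ?big_nil.
- exists (s ++ t); last by rewrite big_cat.
  by move=> y; rewrite mem_cat => /orP[/sG|/tG].
exists (nseq (n y) y); first by move=> _ /nseqP[-> _].
by elim: (n y) => [|m IHm]; rewrite ?big_nil // big_cons -IHm mulrS.
Qed.

(** Up to sign, such a root is a sum of elements of [Gamma]. This removes from the bracket equation
    the triples that contain one. *)
Lemma levi_root a : a \in Omega -> a \in fspan Gamma -> in_levi ad Gamma E (E a).
Proof.
move=> aO aG U U_sub hU GU; have Gamma_Omega y : y \in Gamma -> y \in Omega.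
  by move=> /Gamma_Pi /Pi_sub.
case: Pi_simple => _ _ /(_ a aO)[a_nat|a_nat].
  have [s sG a_s] := nat_comb_span a_nat aG; rewrite a_s in aO *.
  by apply: root_in_subalgebra => // y /sG => [/Gamma_Omega //|/GU[]].
have [|s sG a_s] := nat_comb_span a_nat; first by rewrite rpredN.
have aE : a = \sum_(b <- [seq - b | b <- s]) b by rewrite big_map sumrN -a_s opprK.
rewrite aE in aO *; apply: root_in_subalgebra => // _ /mapP[y /sG yG ->].
  by apply/Omega_opp/Gamma_Omega.
by have [] := GU y yG.
Qed.

Lemma levi_cartan x : x \in h -> in_levi ad Gamma E x.
Proof. by move=> xh U _ /subvP hU _; apply: hU. Qed.

Lemma span_subalgebra (s : seq g) :
  (forall x y, x \in s -> y \in s -> ad x y \in <<s>>%VS) ->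
  lie_subalgebra ad <<s>>%VS.
Proof.
move=> s_sub x y.
move=> /(@coord_span _ _ _ (in_tuple s)) -> /(@coord_span _ _ _ (in_tuple s)) ->.
rewrite linear_sum /=; apply: memv_suml => j _.
rewrite linearZ memvZ //= linear_sum sum_lfunE; apply: memv_suml => i _.
by rewrite linearZ scale_lfunE memvZ //; apply: s_sub; apply: mem_nth.
Qed.

(* The span of h and of the E_b, b in Omega_Gamma, is a subalgebra containing the
   generators of the Levi subalgebra. *)
Lemma killing_levi a x : a \in Omega -> a \notin fspan Gamma ->
  in_levi ad Gamma E x -> killing ad (E a) x = 0.
Proof.
move=> aO aG x_levi; have E_rv b := @root_vectorE _ _ _ _ _ _ E_vectors b.
pose s := vbasis h ++ [seq E b | b <- enum_fset Omega & b \in fspan Gamma].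
have s_span : x \in <<s>>%VS.
  have hs : (h <= <<s>>)%VS.
    by rewrite /s span_cat (span_basis (vbasisP h)) addvSl.
  have Es b : b \in Omega -> b \in fspan Gamma -> E b \in <<s>>%VS.
    move=> bO bG; apply: memv_span; rewrite mem_cat; apply/orP; right.
    by apply: map_f; rewrite mem_filter bG.
  have sP y : y \in s -> y \in h \/
      exists2 b, b \in Omega /\ b \in fspan Gamma & y = E b.
    rewrite mem_cat => /orP[/vbasis_mem|/mapP[b]]; first by left.
    by rewrite mem_filter => /andP[bG bO] ->; right; exists b.
  have h_weight t b : t \in h -> b \in Omega ->
      exists k : R[i], ad t (E b) = k *: E b.
    move=> th bO; exists (b (vsproj h t)).
    by rewrite -(E_rv b bO) vsprojK.
  apply: (x_levi); [apply: span_subalgebra|exact: hs|] => [y z /sP yP /sP zP|b bG].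
    case: yP => [yh|[b [bO bG] ->]]; case: zP => [zh|[d [dO dG] ->]].
    - by case: h_cartan => h_comm _ _; rewrite h_comm ?mem0v.
    - by have [k ->] := h_weight y d yh dO; rewrite memvZ ?Es.
    - have [k zb] := h_weight z b zh bO.
      by rewrite (ad_anti (ad_lie g_simple)) zb memvN memvZ ?Es.
    have [bd0|bd0] := eqVneq (b + d) 0.
      apply: (subvP hs); apply/(root_vector0P h_cartan); rewrite -bd0.
      by apply: (root_vector_ad g_simple); apply: E_rv.
    have [bdO|bdO] := boolP (b + d \in Omega); last first.
      by rewrite (ad_root_eq0 g_simple Omega_roots E_vectors) ?mem0v.
    rewrite (ad_rootE g_simple h_cartan Omega_roots E_vectors (subrr (b + d))) //.
      by rewrite opprK memvZ // Es // rpredD.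
    exact: Omega_opp.
  have bO := Pi_sub (Gamma_Pi bG); have bG' : b \in fspan Gamma by apply: memv_span.
  by split; apply: Es; rewrite ?rpredN //; apply: Omega_opp.
rewrite -killing_formE; move: s_span => /(@coord_span _ _ _ (in_tuple s)) ->.
rewrite linear_sum big1 // => i _; rewrite linearZ /= killing_formE.
suff -> : killing ad (E a) (in_tuple s)`_i = 0 by rewrite scaler0.
have : s`_i \in s by rewrite mem_nth.
rewrite mem_cat => /orP[/vbasis_mem/(root_vector0P h_cartan) th|/mapP[b]].
  apply: (killing_weight g_simple (E_rv a aO) th).
  by rewrite addr0 (root_neq0 Omega_roots).
rewrite mem_filter => /andP[bG bO] ->.
rewrite (killing_root_vectors g_simple E_vectors) //.
by case: eqP => // ba; rewrite ba rpredN (negPf aG) in bG.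
Qed.

Let N := structure_constant ad E.

Lemma structure_constant_rot a b c : N b c a = N a b c.
Proof.
rewrite /N /structure_constant [RHS]killing_invariant; last exact: ad_lie.
exact: killingC.
Qed.

Lemma structure_constant_swap a b c : N b a c = - N a b c.
Proof. by rewrite /N /structure_constant (ad_anti (ad_lie g_simple)) killingNl. Qed.


Notation Q := (quasiroots Omega Gamma).
Notation q := (qproj (fspan Gamma)).

Lemma mem_quasiroots x :
  x \in Q <-> x != 0 /\ exists2 a, a \in Omega & x = q a.
Proof. exact: image_setP. Qed.

Let q_ker v : (q v == 0) = (v \in fspan Gamma) := mem_lker_qproj (fspan Gamma) v.

Lemma quasiroot_opp x : (- x \in Q) = (x \in Q).
Proof. exact: (Q_opp Omega_opp mem_quasiroots). Qed.

Lemma quasiroot_sign x : x \in Q ->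
  positive_quasiroot Omega Pi x \/ positive_quasiroot Omega Pi (- x).
Proof.
move=> xQ; have /mem_quasiroots[_ [a aO xa]] := xQ.
have nxQ : - x \in Q by rewrite quasiroot_opp.
have [_ _ /(_ a aO)[ap|ap]] := Pi_simple; [left|right]; split=> //.
  by exists a => //; rewrite in_fset_filter aO; apply/asboolP.
exists (- a); last by rewrite linearN xa.
by rewrite in_fset_filter Omega_opp //; apply/asboolP.
Qed.

(** Among three quasiroots with sum zero, two can be given the same sign; a rotation brings them to
    the front, and a change of all signs makes them positive. *)
Lemma Z_varietyP (c : {ffun Q -> R[i]}) : Z_variety Pi K c <-> Z_on K c.
Proof.
split=> -[c_odd cZ]; (split; first exact: c_odd); last first.
  move=> a b s _ _ sab.
  have nsQ : - val s \in Q by rewrite quasiroot_opp; exact: valP.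
  have abs0 : val a + val b - val s = 0 by rewrite sab subrr.
  have := cZ _ _ _ (valP a) (valP b) nsQ abs0.
  rewrite /Z_relation (ext0_odd quasiroot_opp) // !ext0E => abs.
  by apply: subr0_eq; apply: oppr_inj; rewrite oppr0 -[RHS]abs; ring.
have pos x y z : x \in Q -> y \in Q -> z \in Q -> x + y + z = 0 ->
    positive_quasiroot Omega Pi x -> positive_quasiroot Omega Pi y ->
    Z_relation K c x y z.
  move=> xQ yQ zQ /eqP; rewrite addr_eq0 => /eqP xyz xp yp.
  have nzQ : - z \in Q by rewrite quasiroot_opp.
  have := cZ [` xQ]%fset [` yQ]%fset [` nzQ]%fset xp yp (esym xyz).
  rewrite -!ext0_in (ext0_odd quasiroot_opp) // => xyzE; rewrite /Z_relation.
  rewrite -[RHS](subrr (ext0 c x * ext0 c y + K ^+ 2)) -[in X in _ - X]xyzE.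
  by ring.
have same x y z : x \in Q -> y \in Q -> z \in Q -> x + y + z = 0 ->
    (positive_quasiroot Omega Pi x /\ positive_quasiroot Omega Pi y) \/
    (positive_quasiroot Omega Pi (- x) /\ positive_quasiroot Omega Pi (- y)) ->
    Z_relation K c x y z.
  move=> xQ yQ zQ xyz [[xp yp]|[xp yp]]; first exact: pos.
  apply: (Z_relationN quasiroot_opp) => //.
  apply: pos; rewrite ?quasiroot_opp //.
  by rewrite -!opprD xyz oppr0.
move=> x y z xQ yQ zQ xyz.
have yzx : y + z + x = 0 by rewrite addrC addrA.
have zxy : z + x + y = 0 by rewrite addrC addrA.
have [xp|xp] := quasiroot_sign xQ; have [yp|yp] := quasiroot_sign yQ;
  have [zp|zp] := quasiroot_sign zQ;
  first [by apply: same => //; tauto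
        |by do 2 apply: Z_relationC; apply: same => //; tauto
        |by apply: Z_relationC; apply: same => //; tauto].
Qed.

Let Om := enum_fset Omega.
Let P := enum_fset (positive_roots Omega Pi).

Lemma positive_rootsP a :
  reflect (a \in Omega /\ nat_comb Pi a) (a \in positive_roots Omega Pi).
Proof.
rewrite in_fset_filter; apply: (iffP andP) => -[aO ap]; split=> //;
  exact/asboolP.
Qed.

Lemma roots_split : perm_eq Om (P ++ [seq - a | a <- P]).
Proof.
apply: uniq_perm => [||a]; first exact: fset_uniq.
  rewrite cat_uniq fset_uniq (map_inj_uniq oppr_inj) fset_uniq andbT /=.
  apply/hasPn => _ /mapP[b /positive_rootsP[bO bp] ->].
  by apply/negP => /positive_rootsP[_]; apply: positive_opp.
rewrite mem_cat; apply/idP/orP => [aO|[|/mapP[b]]].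
- have [_ _ /(_ a aO)[ap|ap]] := Pi_simple; first by left; apply/positive_rootsP.
  right; apply/mapP; exists (- a); last by rewrite opprK.
  by apply/positive_rootsP; split=> //; apply: Omega_opp.
- by case/positive_rootsP.
by case/positive_rootsP => bO _ ->; apply: Omega_opp.
Qed.

(** The odd extension to all roots of the constant coefficient 1 of r. *)
Let sgn (a : dual h) : R[i] := if `[< nat_comb Pi a >] then 1 else - 1.

Lemma sgn_opp a : a \in Omega -> sgn (- a) = - sgn a.
Proof.
move=> aO; rewrite /sgn; case: asboolP => na; case: asboolP => pa //.
- by case: (positive_opp aO pa).
- by rewrite opprK.
by have [_ _ /(_ a aO)[]] := Pi_simple.
Qed.

(** Three roots with sum zero are neither all positive nor all negative, so two of the products are
    - 1 and one is 1. *)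
Lemma sgn_sum a b c : a \in Omega -> b \in Omega -> c \in Omega ->
  a + b + c = 0 -> sgn a * sgn b + sgn b * sgn c + sgn c * sgn a = - 1.
Proof.
have not_all_pos x y z : x \in Omega -> y \in Omega -> z \in Omega ->
    x + y + z = 0 -> nat_comb Pi x -> nat_comb Pi y -> ~ nat_comb Pi z.
  move=> xO yO zO /eqP; rewrite addr_eq0 => /eqP xyz xp yp zp.
  by apply: (positive_opp zO zp); rewrite -xyz; apply: nat_combD.
have neg x : x \in Omega -> ~ nat_comb Pi x -> nat_comb Pi (- x).
  by move=> xO xp; have [_ _ /(_ x xO)[]] := Pi_simple.
move=> aO bO cO abc; rewrite /sgn.
case: asboolP => ap; case: asboolP => bp; case: asboolP => cp; try by ring.
  by case: (not_all_pos a b c).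
case: (not_all_pos (- a) (- b) (- c)); try exact: Omega_opp; try exact: neg.
by rewrite -!opprD abc oppr0.
Qed.

(** * The bracket equation and the equations of the variety *)

Section Brackets.
Variable c : {ffun Q -> R[i]}.
Hypothesis c_odd : odd_coef c.

Let C (a : dual h) : R[i] := ext0 c (q a).

Let coef (a b d : dual h) : R[i] := C a * C b + C b * C d + C d * C a + K ^+ 2.

Let C_odd a : C (- a) = - C a.
Proof. by rewrite /C linearN (ext0_odd quasiroot_opp). Qed.

(** The coefficient - 1 in the sum for r turns the subtraction of K^2 times it into the summand +
    K^2 of [coef]; the common factor 3 cancels. *)
Lemma schouten_equation (xi : 'I_3 -> 'Hom(g, R[i]^o)) :
  (forall i x, in_levi ad Gamma E x -> xi i x = 0) ->
  schouten ad (f_bivector Pi E c) (f_bivector Pi E c) xi =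
    K ^+ 2 * schouten ad (r_bivector Omega Pi E) (r_bivector Omega Pi E) xi <->
  triple_sum Om (fun a b d => coef a b d * triple_term E xi N a b d) = 0.
Proof.
move=> xi_levi; have xi_h i x : x \in h -> xi i x = 0.
  by move=> /levi_cartan; apply: xi_levi.
have xi_opp a i : a \in Om -> xi i (ad (E a) (E (- a))) = 0.
  move=> aO; apply: xi_h; apply/(root_vector0P h_cartan); rewrite -(subrr a).
  apply: (root_vector_ad g_simple); apply: (root_vectorE E_vectors) => //.
  exact: Omega_opp.
have ad_notin a b : a \in Om -> b \in Om -> a + b != 0 -> a + b \notin Om ->
    ad (E a) (E b) = 0.
  exact: (ad_root_eq0 g_simple Omega_roots E_vectors).
have adN a b d : a + b + d = 0 -> a \in Om -> b \in Om -> d \in Om ->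
    ad (E a) (E b) = N a b d *: E (- d).
  move=> abd aO bO dO.
  exact: (ad_rootE g_simple h_cartan Omega_roots E_vectors abd).
have sym := @schouten_symmetrized R g ad _ Om P E xi (fset_uniq Omega) Omega_opp
  roots_split xi_opp ad_notin N adN structure_constant_rot.
have f_sum : 3 * schouten ad (f_bivector Pi E c) (f_bivector Pi E c) xi =
    triple_sum Om (fun a b d =>
      (C a * C b + C b * C d + C d * C a) * triple_term E xi N a b d).
  rewrite /f_bivector (@schouten_support R g ad _ P E xi C) => [|a].
    by apply: sym.
  rewrite negbK -q_ker /C => /eqP ->; apply: ext0_out.
  by apply/negP => /mem_quasiroots[]; rewrite eqxx.
have r_sum : 3 * schouten ad (r_bivector Omega Pi E) (r_bivector Omega Pi E) xi =
    - triple_sum Om (fun a b d => triple_term E xi N a b d).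
  rewrite (sym sgn sgn_opp); last first.
    apply/eq_in_map => a /positive_rootsP[_ ap]; congr (_, _).
    by rewrite /sgn; case: asboolP.
  rewrite -mulN1r triple_sumZ; apply: eq_triple_sum => a b d aO bO dO.
  rewrite /triple_term; case: eqP => abd; last by rewrite !mulr0.
  by rewrite sgn_sum.
set Sf := schouten _ _ _ _ in f_sum *; set Sr := schouten _ _ _ _ in r_sum *.
have -> : triple_sum Om (fun a b d => coef a b d * triple_term E xi N a b d) =
    3 * (Sf - K ^+ 2 * Sr).
  rewrite mulrBr f_sum mulrCA r_sum mulrN opprK triple_sumZ triple_sumD.
  by apply: eq_triple_sum => a b d _ _ _; rewrite /coef mulrDl.
split=> [->|/eqP]; first by rewrite subrr mulr0.
by rewrite mulf_eq0 pnatr_eq0 /= subr_eq0 => /eqP.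
Qed.

Lemma Z_variety_bracket : Z_variety Pi K c <-> bracket_equation ad Pi E K c.
Proof.
rewrite Z_varietyP; split=> [[_ c_rel] xi xi_levi|brack].
  apply/(schouten_equation xi_levi).
  (* Zero is written as a triple sum, to be compared term by term. *)
  rewrite -[RHS](mul0r (triple_sum Om (fun _ _ _ => 0))) triple_sumZ.
  apply: eq_triple_sum => a b d aO bO dO; rewrite mul0r /triple_term.
  case: eqP => abd; last by rewrite mulr0.
  (* A triple with a root in the span of [Gamma] gives no relation between quasiroots, but its
     three-vector vanishes on the allowed forms. *)
  have W0 x y z : x \in Omega -> q x = 0 ->
      wedge3 (E (- x)) (E y) (E z) xi = 0.
    move=> xO /eqP; rewrite q_ker => xG; apply: wedge3_eq0 => i; apply: xi_levi.
    by apply: levi_root; rewrite ?rpredN //; apply: Omega_opp.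
  have [qa|qa] := eqVneq (q a) 0; first by rewrite W0 ?mulr0.
  have [qb|qb] := eqVneq (q b) 0; first by rewrite -wedge3_rot W0 ?mulr0.
  have [qd|qd] := eqVneq (q d) 0; first by rewrite -2!wedge3_rot W0 ?mulr0.
  have QP x : x \in Omega -> q x != 0 -> q x \in Q.
    by move=> xO qx; apply/mem_quasiroots; split=> //; exists x.
  have qabd : q a + q b + q d = 0 by rewrite -!linearD abd linear0.
  have := c_rel _ _ _ (QP a aO qa) (QP b bO qb) (QP d dO qd) qabd.
  by rewrite /Z_relation /coef /C => ->; rewrite mul0r.
split=> // x y z xQ yQ zQ xyz.
have [a [b [d [[aO bO dO] [qa qb qd abd]]]]] := lift_relation Omega_opp Omega_sum
  Pi_free Pi_sub Omega_int Gamma_Pi q_ker mem_quasiroots xQ yQ zQ xyz.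
have not_levi u v : v \in Q -> q u = v -> u \notin fspan Gamma.
  by move=> /mem_quasiroots[v0 _] uv; rewrite -q_ker uv.
have abdO (i : 'I_3) : nth a [:: a; b; d] i \in Omega.
  exact: (nth3_ind (P := fun u => u \in Omega)).
(* These forms are dual to the vectors [E (- u)] by normalization, and they vanish on the Levi
   subalgebra because a, b, d lie outside the span of [Gamma]. *)
pose xi (i : 'I_3) := killing_form ad (E (nth a [:: a; b; d] i)).
have xi_levi i u : in_levi ad Gamma E u -> xi i u = 0.
  move=> u_levi; rewrite /xi killing_formE; apply: killing_levi u_levi.
    exact: abdO.
  apply: (nth3_ind (P := fun u => u \notin fspan Gamma)).
  - exact: not_levi xQ qa.
  - exact: not_levi yQ qb.
  exact: not_levi zQ qd.
have xi_dual i u : u \in Om -> xi i (E (- u)) = (u == nth a [:: a; b; d] i)%:R.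
  move=> uO; rewrite /xi killing_formE.
  rewrite (killing_root_vectors g_simple E_vectors (abdO i) (Omega_opp uO)).
  by rewrite eqr_opp.
have coef_rot u v w : coef v w u = coef u v w by rewrite /coef; ring.
have coef_swap u v w : coef v u w = coef u v w by rewrite /coef; ring.
have := brack xi xi_levi => /(schouten_equation xi_levi).
rewrite (triple_sum_extract (fset_uniq Omega) aO bO dO abd xi_dual
  structure_constant_rot (fun u v w _ => structure_constant_swap u v w)
  coef_rot coef_swap).
move/eqP; rewrite mulf_eq0 pnatr_eq0 /= mulf_eq0.
rewrite (negPf (structure_constant_neq0 g_simple h_cartan Omega_roots E_vectors
  abd dO aO bO)) orbF => /eqP.
by rewrite /coef /C qa qb qd.
Qed.

End Brackets.

Lemma quasiroot_stratum_point (O' : {fset quot (fspan Gamma)})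
    (X : {fset quot (fspan O')}) (lambda : {ffun O' -> R[i]}) :
  linear_subset Omega O' -> semilinear_subset Omega X ->
  multiplicative_map lambda -> regular_map lambda ->
  exists! c : {ffun Q -> R[i]}, Z_variety Pi K c /\ corresponds K X lambda c.
Proof.
move=> O'_linear X_semi lM lreg.
have [c [[cZ cP] c_unique]] :=
  stratum_point K quasiroot_opp O'_linear X_semi lM lreg.
exists c; split; first by split=> //; apply/Z_varietyP.
by move=> c' [/Z_varietyP c'Z c'P]; apply: c_unique.
Qed.

Hypothesis K_neq0 : K != 0.

Lemma quasiroot_decomposition (c : {ffun Q -> R[i]}) : Z_variety Pi K c ->
  exists! O' : {fset quot (fspan Gamma)}, linear_subset Omega O' /\
    exists! X : {fset quot (fspan O')},
      semilinear_subset Omega X /\ in_stratum Pi K X c.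
Proof.
move=> cZ'; have /Z_varietyP cZ := cZ'.
have [O' [[O'_linear [X [[X_semi X_str] X_unique]]] O'_unique]] :=
  stratum_decomposition quasiroot_opp K_neq0 cZ
    (@quasiroot_relation _ _ _ _ _ _ _ _ Omega_opp Omega_sum Pi_free Pi_sub
      Omega_int Gamma_Pi q_ker mem_quasiroots _ _ K_neq0 cZ).
exists O'; split.
  split=> //; exists X; split; first by split.
  by move=> X' [X'_semi [_ X'_str]]; apply: X_unique.
move=> O2 [O2_linear [X2 [[X2_semi [_ X2_str]] X2_unique]]].
apply: O'_unique; split=> //; exists X2; split; first by split.
by move=> X3 [X3_semi X3_str]; apply: X2_unique; split.
Qed.

Lemma quasiroot_parametrization (O' : {fset quot (fspan Gamma)})
    (X : {fset quot (fspan O')}) :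
  linear_subset Omega O' -> semilinear_subset Omega X ->
  (forall lambda : {ffun O' -> R[i]},
     multiplicative_map lambda -> regular_map lambda ->
     exists! c : {ffun Q -> R[i]},
       in_stratum Pi K X c /\ corresponds K X lambda c) /\
  (forall c : {ffun Q -> R[i]}, in_stratum Pi K X c ->
     exists! lambda : {ffun O' -> R[i]},
       [/\ multiplicative_map lambda, regular_map lambda &
           corresponds K X lambda c]).
Proof.
move=> O'_linear X_semi.
have memO' x := mem_linear_in x O'_linear.
split=> [lambda lM lreg|c [/Z_varietyP cZ c_str]]; last first.
  exact: (stratum_parameter quasiroot_opp K_neq0 memO' cZ c_str).
have [c [[cZ cP] c_unique]] := quasiroot_stratum_point O'_linear X_semi lM lreg.
exists c; split.
  split=> //; split=> //.
  exact: (parametrized_in_stratum K_neq0 memO' X_semi lM lreg cP).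
by move=> c' [[c'Z _] c'P]; apply: c_unique.
Qed.

End Assembly.

Unset Implicit Arguments.

Theorem proposition4p4 (R : realType) (g : vectType R[i])
  (ad : 'Hom(g, 'End(g))) (h : {vspace g})
  (Omega Pi Gamma : {fset dual h}) (E : dual h -> g) (K : R[i])
  (g_simple : simple_lie ad)
  (h_cartan : cartan_subalgebra ad h)
  (Omega_roots : forall alpha, alpha \in Omega <-> is_root ad alpha)
  (Pi_simple : simple_roots Omega Pi)
  (Gamma_sub : (Gamma `<=` Pi)%fset)
  (E_vectors : normalized_root_vectors ad Omega E) :
  [/\ (* the two descriptions of Z_K *)
      forall c : {ffun quasiroots Omega Gamma -> R[i]},
        odd_coef c ->
        (Z_variety Pi K c <-> bracket_equation ad Pi E K c),
      (* the data (O', X, lambda) determine a point of Z_K *)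
      forall (O' : {fset quot (fspan Gamma)}) (X : {fset quot (fspan O')})
             (lambda : {ffun O' -> R[i]}),
        linear_subset Omega O' -> semilinear_subset Omega X ->
        multiplicative_map lambda -> regular_map lambda ->
        exists! c : {ffun quasiroots Omega Gamma -> R[i]},
          Z_variety Pi K c /\ corresponds K X lambda c,
      (* Z_K is the disjoint union of the strata *)
      K != 0 ->
        forall c : {ffun quasiroots Omega Gamma -> R[i]},
        Z_variety Pi K c ->
        exists! O' : {fset quot (fspan Gamma)},
          linear_subset Omega O' /\
          exists! X : {fset quot (fspan O')},
            semilinear_subset Omega X /\ in_stratum Pi K X c &
      (* each stratum is parameterized by the regular multiplicative maps *)
      K != 0 ->
        forall (O' : {fset quot (fspan Gamma)}) (X : {fset quot (fspan O')}),
        linear_subset Omega O' -> semilinear_subset Omega X ->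
        (forall lambda : {ffun O' -> R[i]},
           multiplicative_map lambda -> regular_map lambda ->
           exists! c : {ffun quasiroots Omega Gamma -> R[i]},
             in_stratum Pi K X c /\ corresponds K X lambda c) /\
        (forall c : {ffun quasiroots Omega Gamma -> R[i]},
           in_stratum Pi K X c ->
           exists! lambda : {ffun O' -> R[i]},
             [/\ multiplicative_map lambda, regular_map lambda &
                 corresponds K X lambda c])].
Proof.
split.
- by move=> c c_odd; apply: Z_variety_bracket.
- move=> O' X lambda; exact: (quasiroot_stratum_point K g_simple h_cartan
    Omega_roots Pi_simple E_vectors).
- move=> K_neq0 c; exact: (quasiroot_decomposition g_simple h_cartan Omega_roots
    Pi_simple Gamma_sub E_vectors K_neq0).
move=> K_neq0 O' X; exact: (quasiroot_parametrization g_simple h_cartan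
  Omega_roots Pi_simple E_vectors K_neq0).
Qed.
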